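(* Let $0<p<1$, $0<r<1$ and let $K\ge 2$ be an integer with $\frac1K<\frac{r}{p+r}$. Consider a network with periodic packet arrivals with period $K$ over the Gilbert-Elliott erasure channel $GE(p,r)$ under the first-come-first-served (FCFS) policy. For $s,s'\in\{G,B\}$ and $0\le n\le K$ let $P(K,n,s'|s)$ be the probability that exactly $n$ of the slots $1,\dots,K$ have channel state $G$ and slot $K+1$ has channel state $s'$, given that slot $1$ has channel state $s$. Let $\beta\in(0,1)$ satisfy $$\frac{\beta-\sum_{i=0}^K\beta^iP(K,i,B|B)}{\sum_{i=0}^K\beta^iP(K,i,G|B)}=\frac{\sum_{i=0}^K\beta^iP(K,i,B|G)}{\beta-\sum_{i=0}^K\beta^iP(K,i,G|G)},$$ and let $(p_{0,G},p_{0,B},p_{1,G})^T$ be the solution of the linear system $\mathbf{A}\,(p_{0,G},p_{0,B},p_{1,G})^T=(0,0,1)^T$, where $\mathbf{A}$ is the $3\times 3$ matrix $$\mathbf{A}=\begin{pmatrix}1-\sum_{j=1}^KP(K,j,G|G) & -\sum_{i=0}^{K-1}\beta^i\sum_{j=i+1}^KP(K,j,G|B) & -\sum_{i=0}^{K-2}\beta^i\sum_{j=i+2}^KP(K,j,G|G)\\ \sum_{j=1}^KP(K,j,B|G) & \sum_{i=0}^{K-1}\beta^i\sum_{j=i+1}^KP(K,j,B|B)-1 & \sum_{i=0}^{K-2}\beta^i\sum_{j=i+2}^KP(K,j,B|G)\\ 1&\frac1{1-\beta}&\frac1{1-\beta}\end{pmatrix}.$$ Then the average age of information is $$\bar\Delta_{pF}=p_{0,G}+\frac{1}{r(1-\beta)}\left(1+\frac{r+\beta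 p}{1-\beta}\right)p_{0,B}+\frac{1}{1-\beta}\left(1+\frac{p+r}{r(1-\beta)}\right)p_{1,G}+\frac{K-1}{2}.$$
   Context: Time is slotted, $t=1,2,\dots$. Packets are generated (equivalently, arrive at the transmitter) at the beginning of a slot. At most one packet is transmitted per slot; a packet transmitted in slot $t$ and not erased is received at the end of slot $t$, i.e. is available at the receiver at the beginning of slot $t+1$. A packet may be transmitted in the same slot in which it is generated. Channel $GE(p,r)$: the channel state is a two-state Markov chain on $\{G,B\}$ (one step per slot) with transition probability $p$ from $G$ to $B$ and $r$ from $B$ to $G$. A transmission in a slot with state $G$ always succeeds (erasure probability $0$), and in a slot with state $B$ always fails (erasure probability $1$). Periodic arrival with parameter $K$: a new packet arrives exactly at slots $iK+1$, $i=0,1,2,\dots$, and no packet arrives at other slots. FCFS policy: the transmitter has an infinite buffer (initially empty) and serves packets in order of generation; a packet is transmitted, repeatedly until success, only after all earlier packets have been successfully delivered. Age of information (AoI): at the beginning of slot $t$, $\Delta_t=t-u_t$, where $u_t$ is the generation slot of the latest (most recently generated) packet received by the beginning of slot $t$. The average AoI is the long-run time average $\lim_{\tau\to\infty}\frac1\tau\sum_{t=1}^{\tau}\Delta_t$ (almost surely; the value assigned before the first delivery is irrelevant). Interpretation of notation: $p_{n,s}$ stands for the stationary probability that an arriving packet finds $n$ packets already in the transmitter queue (not counting itself) and channel state $s$ in its arrival slot. *)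

(* Defs.v *)
From HB Require Import structures.
From mathcomp Require Import all_boot all_order all_algebra.
From mathcomp Require Import all_classical all_reals all_analysis.

Set Implicit Arguments.
Unset Strict Implicit.
Unset Printing Implicit Defensive.

Import Order.TTheory GRing.Theory Num.Theory numFieldNormedType.Exports.

Local Open Scope classical_set_scope.
Local Open Scope ring_scope.

Notation chstate := bool (only parsing).
Notation Good := (true : chstate).
Notation Bad := (false : chstate).

(* One-step transition probability of GE(p, r) from state s to state s'. *)
Definition ge_trans (R : realType) (p r : R) (s s' : chstate) : R :=
  match s, s' with
  | true, true => 1 - p
  | true, false => p
  | false, true => r
  | false, false => 1 - r
  end.

(* S t is the channel state in slot t, for t >= 1; S 0 is not a slot and is
   left unconstrained. The conditional probability of the next state given the
   whole past is written multiplicatively, so that pasts of probability 0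
   impose nothing. The initial distribution, that of S 1, is arbitrary. *)
Definition is_GE_channel (d : measure_display) (T : measurableType d)
    (R : realType) (P : probability T R) (p r : R)
    (S : nat -> {RV P >-> chstate}) : Prop :=
  forall (t : nat) (h : nat -> chstate), (0 < t)%N ->
    (P [set w | forall i, (1 <= i <= t.+1)%N -> S i w = h i]
     = P [set w | forall i, (1 <= i <= t)%N -> S i w = h i]
       * (ge_trans p r (h t) (h t.+1))%:E)%E.

(* PK p r K n s' s is P(K,n,s'|s). A state path over the slots 1, ..., K+1 is
   encoded by x : {ffun 'I_K.+1 -> chstate}, where x i is the state in slot i+1;
   given x ord0 = s, it has probability
   \prod_(i < K) ge_trans p r (x i) (x i.+1). See PK_cond below. *)
Definition PK (R : realType) (p r : R) (K n : nat) (s' s : chstate) : R :=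
  \sum_(x : {ffun 'I_K.+1 -> chstate} |
        [&& x ord0 == s, x ord_max == s'
          & #|[pred i : 'I_K | x (widen_ord (leqnSn K) i) == Good]| == n])
    \prod_(i < K) ge_trans p r (x (widen_ord (leqnSn K) i)) (x (lift ord0 i)).

Definition arrival (K t : nat) : bool := (0 < t)%N && (K %| t.-1)%N.

(* Packets are identified with their generation slots. A system state
   (q, rcv) consists of the transmitter queue q, oldest packet first, and the
   list rcv of the packets received so far. *)
Definition fcfs_step (K t : nat) (s : chstate) (x : seq nat * seq nat) :
    seq nat * seq nat :=
  let: (q, rcv) := x in
  let q1 := if arrival K t then rcons q t else q in
  match s, q1 with
  | true, u :: q2 => (q2, u :: rcv)
  | _, _ => (q1, rcv)
  end.

(* fcfs K s n is the system state at the end of slot n, that is, at the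
   beginning of slot n+1 before any arrival there. *)
Fixpoint fcfs (K : nat) (s : nat -> chstate) (n : nat) : seq nat * seq nat :=
  match n with
  | 0 => ([::], [::])
  | n'.+1 => fcfs_step K n (s n) (fcfs K s n')
  end.

(* u_t, with value 0 before the first delivery. *)
Definition latest_received (K : nat) (s : nat -> chstate) (t : nat) : nat :=
  \max_(u <- (fcfs K s t.-1).2) u.

Definition aoi (R : realType) (K : nat) (s : nat -> chstate) (t : nat) : R :=
  t%:R - (latest_received K s t)%:R.

Definition avg_aoi (R : realType) (K : nat) (s : nat -> chstate) (tau : nat) : R :=
  tau%:R^-1 * \sum_(1 <= t < tau.+1) aoi R K s t.

Definition PKtail (R : realType) (p r : R) (K m : nat) (s' s : chstate) : R :=
  \sum_(m <= j < K.+1) PK p r K j s' s.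

Definition matA (R : realType) (p r : R) (K : nat) (beta : R) : 'M[R]_3 :=
  \matrix_(i < 3, j < 3) nth 0 (nth [::]
   [:: [:: 1 - PKtail p r K 1 Good Good;
           - \sum_(0 <= i < K) beta ^+ i * PKtail p r K i.+1 Good Bad;
           - \sum_(0 <= i < K.-1) beta ^+ i * PKtail p r K i.+2 Good Good];
       [:: PKtail p r K 1 Bad Good;
           \sum_(0 <= i < K) beta ^+ i * PKtail p r K i.+1 Bad Bad - 1;
           \sum_(0 <= i < K.-1) beta ^+ i * PKtail p r K i.+2 Bad Good];
       [:: 1; (1 - beta)^-1; (1 - beta)^-1]] i) j.

Definition col3 (R : realType) (a b c : R) : 'cV[R]_3 :=
  \col_(i < 3) nth 0 [:: a; b; c] i.

Section PK_cond.
Context (d : measure_display) (T : measurableType d) (R : realType)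
  (P : probability T R) (p r : R) (S : nat -> {RV P >-> chstate}).
Hypothesis GE : is_GE_channel p r S.

Lemma measurable_state t s : measurable [set w | S t w = s].
Proof.
by have := @measurable_funPTI _ _ _ _ (S t) [set s] Logic.I.
Qed.

Let cyl (n : nat) (h : nat -> chstate) : set T :=
  [set w | forall i, (1 <= i <= n)%N -> S i w = h i].

Let cyl_prob h n :
  P (cyl n.+1 h) = (P [set w | S 1%N w = h 1%N]
    * (\prod_(i < n) ge_trans p r (h i.+1) (h i.+2))%:E)%E.
Proof.
elim: n => [|n IH].
  rewrite big_ord0 mule1; congr (P _); apply/seteqP; split => w /= H.
    exact: H.
  by move=> i; rewrite -eqn_leq => /eqP <-.
rewrite /cyl (GE h (ltn0Sn n)) big_ord_recr /= EFinM muleA -IH //.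
Qed.

Let cyl_meas n h : measurable (cyl n h).
Proof.
rewrite (_ : cyl n h = \bigcap_(i in [set i | (1 <= i <= n)%N])
   [set w | S i w = h i]) //.
by apply: bigcap_measurableType => i _; exact: measurable_state.
Qed.

Let bigsetU_prob (I : choiceType) (l : seq I) (F : I -> set T) : uniq l ->
  (forall x, measurable (F x)) ->
  (forall x y w, F x w -> F y w -> x = y) ->
  P [set w | exists2 x, x \in l & F x w] = (\sum_(x <- l) P (F x))%E.
Proof.
move=> + mF dF; elim: l => [_|x l IH /= /andP[xl ul]].
  by rewrite big_nil (_ : mkset _ = set0) ?measure0// -subset0 => w [].
have -> : [set w | exists2 y, y \in x :: l & F y w] =
    F x `|` [set w | exists2 y, y \in l & F y w].
  apply/seteqP; split => w /=.
    by move=> [y]; rewrite inE => /orP[/eqP->|yl] Fy; [left|right; exists y].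
  move=> [Fx|[y yl Fy]]; first by exists x => //; exact: mem_head.
  by exists y => //; rewrite inE yl orbT.
rewrite big_cons -(IH ul) measureU//.
- have -> : [set w | exists2 y, y \in l & F y w] = \big[setU/set0]_(y <- l) F y.
    by rewrite -bigcup_seq.
  exact: bigsetU_measurable.
- rewrite -subset0 => w /= [Fx [y yl Fy]].
  by move: xl; rewrite (dF _ _ _ Fx Fy) yl.
Qed.

(* P(K,n,s'|s) is the conditional probability under any GE(p, r) channel. *)
Lemma PK_cond (K n : nat) (s' s : chstate) : P [set w | S 1%N w = s] != 0%E ->
  PK p r K n s' s =
  fine (P [set w | [/\ S 1%N w = s, S K.+1 w = s'
                    & #|[pred i : 'I_K | S i.+1 w == Good]| = n]])
  / fine (P [set w | S 1%N w = s]).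
Proof.
move=> Ps0.
pose h (x : {ffun 'I_K.+1 -> chstate}) (i : nat) := x (inord i.-1).
pose Q (x : {ffun 'I_K.+1 -> chstate}) := [&& x ord0 == s, x ord_max == s'
          & #|[pred i : 'I_K | x (widen_ord (leqnSn K) i) == Good]| == n].
pose X w : {ffun 'I_K.+1 -> chstate} := [ffun i : 'I_K.+1 => S i.+1 w].
have cylX x w : cyl K.+1 (h x) w <-> X w = x.
  split=> [H|<- i /andP[i0 iK]].
    apply/ffunP => i; rewrite ffunE H ?ltn_ord//.
    by rewrite /h /= inord_val.
  by rewrite /h ffunE inordK ?prednK// -ltnS prednK.
have QX w : Q (X w) <-> [/\ S 1%N w = s, S K.+1 w = s'
                    & #|[pred i : 'I_K | S i.+1 w == Good]| = n].
  rewrite /Q !ffunE /=.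
  have -> : #|[pred i : 'I_K | X w (widen_ord (leqnSn K) i) == Good]| =
            #|[pred i : 'I_K | S i.+1 w == Good]|.
    by apply: eq_card => i; rewrite !inE ffunE.
  by split=> [/and3P[/eqP ? /eqP ? /eqP ?]|[-> -> ->]]; rewrite ?eqxx.
set E := mkset _.
have -> : E = [set w | exists2 x, x \in [seq x <- index_enum _ | Q x] & cyl K.+1 (h x) w].
  apply/seteqP; split => w /=.
    move=> /QX Qw; exists (X w); last exact/cylX.
    by rewrite mem_filter Qw mem_index_enum.
  by move=> [x]; rewrite mem_filter => /andP[Qx _] /cylX Xw; apply/QX; rewrite Xw.
rewrite bigsetU_prob.
- have Pf : P [set w | S 1%N w = s] \is a fin_num.
    by apply: fin_num_measure; exact: measurable_state.
  have -> : (\sum_(x <- [seq x <- index_enum _ | Q x]) P (cyl K.+1 (h x)) =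
             (fine (P [set w | S 1%N w = s]) * PK p r K n s' s)%:E)%E.
    rewrite /PK big_filter mulr_sumr -sumEFin; apply: eq_bigr => x /and3P[/eqP xs _ _].
    rewrite cyl_prob EFinM fineK// {1}/h /= (_ : inord 0 = ord0) ?xs; last first.
      by apply/val_inj; rewrite /= inordK.
    congr (_ * _%:E)%E; apply: eq_bigr => i _; rewrite /h /=.
    congr (ge_trans _ _ (x _) (x _)); apply/val_inj; rewrite /= inordK//.
      by rewrite ltnS ltnW.
    by rewrite ltnS.
  rewrite /= mulrAC divff ?mul1r//.
  by apply: contra Ps0 => /eqP P0; rewrite -(fineK Pf) P0.
- by rewrite filter_uniq// index_enum_uniq.
- by move=> x; exact: cyl_meas.
- by move=> x y w /cylX <- /cylX <-.
Qed.

End PK_cond.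

(* Main.v *)
(* Let Z_t be the queue length at the end of slot t together with the channel
   state of slot t+1. After the first delivery the age at the beginning of slot
   t+1 is the time elapsed since the last arrival, counted from 1, plus K times
   the queue length, so the average age is governed by the average queue length.

   Observed just before arrivals, Z is a Markov chain on nat * {Good, Bad}. The
   linear system yields a strictly positive invariant probability
   pi(n, B) = beta^n p0B, pi(n+1, G) = beta^n p1G, pi(0, G) = p0G: the equation
   for beta makes the balance equations at the levels n >= 1 singular, and
   conservation of mass, which is the sum of the first two rows, forces
   (p1G / beta, p0B) into the kernel.

   The chain starts at level 0, so all its marginals are bounded by multiples of
   pi and the queue length has bounded moments. Hence for every potential f of
   at most quadratic growth the martingale part of f(Z_t) has second moment O(t),
   and by Borel-Cantelli along squares the averages of the drift of f tend to 0
   almost surely. Applied to indicators this makes every ultrafilter limit of the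
   empirical frequencies invariant, hence a multiple c * pi, by uniqueness of the
   invariant measure; applied to the linear potential, which measures idle slots,
   it gives c = 1 because the load is less than 1. Applied to the total
   remaining sojourn time of the queued packets, a quadratic potential, it gives
   Little's law (average queue length in terms of the average sojourn time) and
   also expresses the average sojourn time through finitely many frequencies.
   The same identities hold for pi, so the limit is the pi-mean of the sojourn
   time. *)

Require Import Defs.
From mathcomp Require Import all_boot all_order all_algebra.
From mathcomp Require Import all_classical all_reals all_analysis.
From mathcomp Require Import ring lra zify.

Set Implicit Arguments.
Unset Strict Implicit.
Unset Printing Implicit Defensive.

Import Order.TTheory GRing.Theory Num.Theory numFieldNormedType.Exports.

Local Open Scope classical_set_scope.
Local Open Scope ring_scope.

Lemma sum_bool (V : nmodType) (F : bool -> V) :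
  \sum_(s : bool) F s = F true + F false.
Proof. by rewrite big_bool. Qed.

(** * The counts P(K,n,s'|s) *)

Section PathCounts.
Variables (R : realType) (p r : R).
Local Notation tr := (Defs.ge_trans p r).
Local Notation PK := (PK p r).

Lemma PK0 (j : nat) (s' s : bool) :
  PK 0 j s' s = ((s' == s) && (j == 0%N))%:R.
Proof.
rewrite /Defs.PK.
under eq_bigr do rewrite big_ord0.
have card0' (x : {ffun 'I_1 -> bool}) :
    #|[pred i : 'I_0 | x (widen_ord (leqnSn 0) i) == Good]| = 0%N.
  by apply: eq_card0 => -[].
have -> : (\sum_(x : {ffun 'I_1 -> bool} | [&& x ord0 == s, x ord_max == s' &
      #|[pred i : 'I_0 | x (widen_ord (leqnSn 0) i) == Good]| == j]) 1 : R) =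
    \sum_(x : {ffun 'I_1 -> bool} | x == [ffun=> s]) ((s' == s) && (j == 0%N))%:R.
  rewrite big_mkcond [RHS]big_mkcond; apply: eq_bigr => x _.
  have -> : (x == [ffun=> s]) = (x ord0 == s).
    apply/eqP/eqP => [->|x0]; first by rewrite ffunE.
    by apply/ffunP => i; rewrite ffunE ord1 x0.
  rewrite card0' (_ : ord_max = ord0); last exact/val_inj.
  case: (x ord0) s s' => -[] [] //=; rewrite eq_sym; by case: eqP.
by rewrite big_pred1_eq.
Qed.

(** The first slot is split off. It is itself counted when good, so the tail must contain [j - s]
    good slots, with [s] read as a number; the guard keeps truncated subtraction from admitting
    spurious paths. *)
Lemma PKS (k j : nat) (s' s : bool) :
  PK k.+1 j s' s =
  \sum_(s1 : bool) tr s s1 * (if (s <= j)%N then PK k (j - s)%N s' s1 else 0).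
Proof.
pose cns (y : {ffun 'I_k.+1 -> bool}) : {ffun 'I_k.+2 -> bool} :=
  [ffun i => oapp y s (unlift ord0 i)].
pose tl (x : {ffun 'I_k.+2 -> bool}) : {ffun 'I_k.+1 -> bool} :=
  [ffun i => x (lift ord0 i)].
have cnsL y i : cns y (lift ord0 i) = y i by rewrite ffunE liftK.
have cns0 y : cns y ord0 = s by rewrite ffunE unlift_none.
have cnsK y : tl (cns y) = y by apply/ffunP => i; rewrite ffunE cnsL.
have cnsM y : cns y ord_max = y ord_max.
  by rewrite -(cnsL y); congr (cns y _); apply/val_inj.
have w0 : widen_ord (leqnSn k.+1) ord0 = ord0 by apply/val_inj.
have wL i : widen_ord (leqnSn k.+1) (lift ord0 i) =
            lift ord0 (widen_ord (leqnSn k) i) by apply/val_inj.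
have cardc y :
    #|[pred i : 'I_k.+1 | cns y (widen_ord (leqnSn k.+1) i) == Good]| =
    (s + #|[pred i : 'I_k | y (widen_ord (leqnSn k) i) == Good]|)%N.
  rewrite -!sum1_card big_mkcond big_ord_recl /= inE w0 cns0 eqb_id.
  congr (_ + _)%N.
  by rewrite [RHS]big_mkcond; apply: eq_bigr => i _; rewrite !inE wL cnsL.
rewrite /Defs.PK (reindex_onto cns tl); last first.
  move=> x /and3P[/eqP x0 _ _]; apply/ffunP => i; rewrite !ffunE.
  by case: unliftP => [i' ->|->] /=; rewrite ?ffunE.
rewrite (partition_big (fun y : {ffun 'I_k.+1 -> bool} => y ord0) predT) //=.
apply: eq_bigr => s1 _.
case: leqP => sj; last first.
  rewrite mulr0 big_pred0// => y; rewrite cardc.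
  by rewrite (_ : (_ + _ == j)%N = false) ?andbF//; apply/eqP; lia.
rewrite mulr_sumr; apply: eq_big => [y|y].
  rewrite cns0 cnsM cardc cnsK !eqxx andbT /= andbC; congr (_ && (_ && _)).
  by rewrite -{2}(addKn s #|_|) eqn_sub2rE ?leq_addr.
case/andP=> _ /eqP <-.
rewrite big_ord_recl w0 cns0 cnsL; congr (_ * _).
by apply: eq_bigr => i _; rewrite wL !cnsL.
Qed.

Lemma PK_ge0 k j s' s : 0 <= p <= 1 -> 0 <= r <= 1 -> 0 <= PK k j s' s.
Proof.
move=> /andP[p0 p1] /andP[r0 r1].
rewrite /Defs.PK sumr_ge0// => x _; rewrite prodr_ge0// => i _.
by case: (x _) (x _) => -[] /=; rewrite ?subr_ge0.
Qed.

Lemma PK_gt k j s' s : (k < j)%N -> PK k j s' s = 0.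
Proof.
elim: k j s => [|k IH] j s kj; first by rewrite PK0 gtn_eqF ?andbF.
rewrite PKS big1// => s1 _; case: ifP; rewrite ?mulr0//.
by rewrite IH ?mulr0//; case: (s) => /=; lia.
Qed.

Lemma PK_Good0 k s' : (0 < k)%N -> PK k 0 s' Good = 0.
Proof. by case: k => // k _; rewrite PKS big1// => s1 _; rewrite mulr0. Qed.

(* The expectation of Phi(number of good slots among 1..k, state of slot k+1),
   given that slot 1 has state s. *)
Definition path_mean k (Phi : nat -> bool -> R) s : R :=
  \sum_(j < k.+1) \sum_(s' : bool) PK k j s' s * Phi j s'.

Lemma path_mean0 Phi s : path_mean 0 Phi s = Phi 0%N s.
Proof.
rewrite /path_mean big_ord1 big_bool !PK0 eqxx !andbT.
by case: s; rewrite /= !(mul0r, mul1r) ?addr0 ?add0r.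
Qed.

Lemma path_meanS k Phi s : path_mean k.+1 Phi s =
  \sum_(s1 : bool) tr s s1 * path_mean k (fun j => Phi (s + j)%N) s1.
Proof.
rewrite /path_mean.
have -> : \sum_(j < k.+2) \sum_(s' : bool) PK k.+1 j s' s * Phi j s' =
   \sum_(s1 : bool) tr s s1 * \sum_(j < k.+2) \sum_(s' : bool)
     (if (s <= j)%N then PK k (j - s)%N s' s1 else 0) * Phi j s'.
  under eq_bigr => j _.
    under eq_bigr => s' _ do rewrite PKS mulr_suml.
    rewrite exchange_big; over.
  rewrite exchange_big; apply: eq_bigr => s1 _; rewrite mulr_sumr.
  apply: eq_bigr => j _; rewrite mulr_sumr.
  by apply: eq_bigr => s' _; rewrite mulrA.
apply: eq_bigr => s1 _; congr (_ * _); case: s => /=.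
  rewrite big_ord_recl /= big1 ?add0r => [|s' _]; last by rewrite mul0r.
  by apply: eq_bigr => j _; apply: eq_bigr => s' _; rewrite /bump /= add1n subSS subn0.
rewrite big_ord_recr /= [X in _ + X]big1 ?addr0 => [|s' _].
  by apply: eq_bigr => j _; apply: eq_bigr => s' _; rewrite subn0.
by rewrite subn0 PK_gt// mul0r.
Qed.

Lemma eq_path_mean k Phi Psi s :
  (forall j s', (j <= k)%N -> Phi j s' = Psi j s') ->
  path_mean k Phi s = path_mean k Psi s.
Proof.
move=> e; apply: eq_bigr => j _; apply: eq_bigr => s' _.
by rewrite e// -ltnS.
Qed.

Lemma path_meanD k Phi Psi s :
  path_mean k (fun j s' => Phi j s' + Psi j s') s = path_mean k Phi s + path_mean k Psi s.
Proof.
rewrite /path_mean -big_split; apply: eq_bigr => j _.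
by rewrite -big_split; apply: eq_bigr => s' _; rewrite mulrDr.
Qed.

Lemma path_meanZ k c Phi s :
  path_mean k (fun j s' => c * Phi j s') s = c * path_mean k Phi s.
Proof.
rewrite /path_mean mulr_sumr; apply: eq_bigr => j _.
by rewrite mulr_sumr; apply: eq_bigr => s' _; rewrite mulrCA.
Qed.

Lemma tr_sum1 s : \sum_(s1 : bool) tr s s1 = 1.
Proof. by rewrite big_bool; case: s => /=; rewrite ?subrK// addrC subrK. Qed.

Lemma path_mean_cst k c s : path_mean k (fun _ _ => c) s = c.
Proof.
elim: k s => [|k IH] s; first by rewrite path_mean0.
rewrite path_meanS; under eq_bigr do rewrite IH.
by rewrite -mulr_suml tr_sum1 mul1r.
Qed.

End PathCounts.

(** * Strict positivity of path probabilities *)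

Section Positivity.
Variables (R : realType) (p r : R).
Hypotheses (hp : 0 < p < 1) (hr : 0 < r < 1).
Local Notation PK := (PK p r).

Let p0 : 0 < p. Proof. by case/andP: hp. Qed.
Let p1 : p < 1. Proof. by case/andP: hp. Qed.
Let r0 : 0 < r. Proof. by case/andP: hr. Qed.
Let r1 : r < 1. Proof. by case/andP: hr. Qed.

Lemma PKp_ge0 k j s' s : 0 <= PK k j s' s.
Proof. by apply: PK_ge0; rewrite !ltW. Qed.
Hint Resolve PKp_ge0 : core.

Lemma PK_allG k : 0 < PK k k Good Good.
Proof.
elim: k => [|k IH]; first by rewrite PK0.
rewrite PKS big_bool /= subn1 /=.
by rewrite ltr_pwDl// ?mulr_ge0 ?mulr_gt0 ?subr_gt0// ltW.
Qed.

Lemma PK_allG_Bad k : 0 < PK k.+1 k.+1 Bad Good.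
Proof.
elim: k => [|k IH]; first by rewrite PKS big_bool /= subnn !PK0 /= ?mulr0 ?mulr1 ?add0r ?addr0.
rewrite PKS big_bool /= subn1 /=.
by rewrite ltr_pwDl// ?mulr_ge0 ?mulr_gt0 ?subr_gt0// ltW.
Qed.

Lemma PK_allB_Good k : 0 < PK k.+1 0 Good Bad.
Proof.
elim: k => [|k IH]; first by rewrite PKS big_bool /= subnn !PK0 /= ?mulr0 ?mulr1 ?add0r ?addr0.
rewrite PKS big_bool /= subn0 PK_Good0// mulr0 add0r.
by rewrite mulr_gt0 ?subr_gt0.
Qed.

Lemma path_mean_gt0 k Phi s (j : 'I_k.+1) s' :
  (forall j s', (j <= k)%N -> 0 <= PK k j s' s * Phi j s') ->
  0 < PK k j s' s * Phi j s' -> 0 < path_mean p r k Phi s.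
Proof.
move=> Phi0 Phigt0; rewrite /path_mean (bigD1 j)//= (bigD1 s')//= -addrA.
apply: ltr_pwDl => //; apply: addr_ge0; apply: sumr_ge0 => i _.
  by apply: Phi0; rewrite -ltnS.
by apply: sumr_ge0 => s1 _; apply: Phi0; rewrite -ltnS.
Qed.

End Positivity.

(** * The invariant probability *)

Section Stationary.
Variables (R : realType) (p r : R) (K : nat) (beta : R).
Hypotheses (hp : 0 < p < 1) (hr : 0 < r < 1) (hK : (2 <= K)%N).
Hypothesis hbeta : 0 < beta < 1.
Local Notation PK := (PK p r).
Local Notation tr := (Defs.ge_trans p r).
Local Notation path_mean := (path_mean p r).

Let beta0 : 0 < beta. Proof. by case/andP: hbeta. Qed.
Let beta1 : beta < 1. Proof. by case/andP: hbeta. Qed.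

(** Generating function of the number of good slots in a period, at the point [beta]. Over [s] and
    [s'] it forms a 2 by 2 matrix, and the equation for [beta] says that [beta] is an eigenvalue of
    it. *)
Definition genf s' s : R := \sum_(0 <= i < K.+1) beta ^+ i * PK K i s' s.

Lemma path_mean_genf f s :
  path_mean K (fun j s' => beta ^+ j * f s') s = \sum_(s' : bool) f s' * genf s' s.
Proof.
rewrite /path_mean exchange_big; apply: eq_bigr => s' _.
rewrite /genf big_mkord mulr_sumr; apply: eq_bigr => j _.
by ring.
Qed.

(** Slot 1 is good and counted, so [beta ^+ j <= beta] on every path of positive probability; the
    all-good path that ends in Bad makes the inequality strict. *)
Lemma genfGG_lt : genf Good Good < beta.
Proof.
rewrite -subr_gt0.
have -> : beta - genf Good Good =
    path_mean K (fun j s' => beta - beta ^+ j * s'%:R) Good.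
  rewrite (@eq_path_mean _ _ _ _ _ (fun j s' => beta + (-1) * (beta ^+ j * s'%:R))); last first.
    by move=> j s' _; rewrite mulN1r.
  rewrite path_meanD path_meanZ path_mean_cst path_mean_genf big_bool /=.
  by rewrite mul1r mul0r addr0 mulN1r.
apply: (@path_mean_gt0 _ p r K _ _ ord_max Bad) => /=.
  case=> [|j] s' _; first by rewrite PK_Good0 ?mul0r//; lia.
  apply: mulr_ge0; first exact: PKp_ge0.
  rewrite subr_ge0; case: s' => /=; last by rewrite mulr0 ltW.
  rewrite mulr1 exprS ger_pMr//; exact: exprn_ile1 (ltW beta0) (ltW beta1).
rewrite mulr0 subr0 mulr_gt0//.
by case: K hK => // k _; exact: PK_allG_Bad.
Qed.

Lemma genf_gt0 s' s j : (j <= K)%N -> 0 < PK K j s' s -> 0 < genf s' s.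
Proof.
move=> jK PK0; rewrite /genf big_mkord (bigD1 (Ordinal (jK : (j < K.+1)%N)))//=.
apply: ltr_pwDl; first by rewrite mulr_gt0// exprn_gt0.
by apply: sumr_ge0 => i _; apply: mulr_ge0; [exact/exprn_ge0/ltW|exact: PKp_ge0].
Qed.

Lemma genfBG_gt0 : 0 < genf Bad Good.
Proof.
apply: (@genf_gt0 _ _ K) => //; case: K hK => // k _; exact: PK_allG_Bad.
Qed.

Lemma genfGB_gt0 : 0 < genf Good Bad.
Proof. by apply: (@genf_gt0 _ _ 0) => //; case: K hK => // k _; exact: PK_allB_Good. Qed.

(** Otherwise the constant 1 would be an eigenfunction of the K-slot operator for [beta]. That
    operator commutes with the one-slot operator, which maps 1 to [beta ^+ s], so this would be an
    eigenfunction too; comparing both at Bad gives [beta = 1]. *)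
Lemma genf_sum_neq : ~ (genf Good Good + genf Bad Good = beta /\
  genf Good Bad + genf Bad Bad = beta).
Proof.
case=> eG eB.
pose h k (f : bool -> R) (s : bool) : R := path_mean k (fun j s' => beta ^+ j * f s') s.
pose A (f : bool -> R) (s : bool) : R := beta ^+ (s : nat) * \sum_(s1 : bool) tr s s1 * f s1.
have hS k f : h k.+1 f = A (h k f).
  apply/funext => s; rewrite /h /A path_meanS mulr_sumr; apply: eq_bigr => s1 _.
  rewrite [RHS]mulrCA; congr (_ * _); rewrite -path_meanZ; apply: eq_path_mean => j s' _.
  by rewrite exprD mulrA.
have hA k f : h k (A f) = A (h k f).
  elim: k => [|k IH]; last by rewrite hS IH -hS.
  have h0 g : h 0%N g = g by apply/funext => s; rewrite /h path_mean0 mul1r.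
  by rewrite !h0.
have h1 : h K (fun=> 1) = fun=> beta.
  by apply/funext => -[]; rewrite /h path_mean_genf big_bool/= !mul1r.
have := congr1 (@^~ Bad) (hA K (fun=> 1)); rewrite h1 /h /A path_mean_genf !big_bool /=.
rewrite expr0 expr1 => e.
have : (beta - 1) * genf Good Bad = 0 by lra.
move/eqP; rewrite mulf_eq0 (gt_eqF genfGB_gt0) orbF subr_eq0 => /eqP b1.
by move: beta1; rewrite b1 ltxx.
Qed.

(** Turns the tail sums in [matA] into geometric sums weighted by path probabilities, with [d = 0]
    for the Bad column and [d = 1] for the Good one. *)
Lemma sum_tail (a X : nat -> R) d :
  \sum_(0 <= i < K - d) a i * \sum_((i + d).+1 <= j < K.+1) X j =
  \sum_(0 <= j < K.+1) X j * \sum_(0 <= i < j - d) a i.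
Proof.
transitivity (\sum_(0 <= i < K) \sum_(0 <= j < K.+1)
    (if (i + d < j)%N then a i * X j else 0)).
  rewrite (big_nat_widen _ _ K) ?leq_subr// big_mkcond !big_mkord.
  apply: eq_bigr => i _ /=; case: ifP => ik.
    rewrite mulr_sumr (big_nat_widenl _ 0)// big_mkcond big_mkord.
    by apply: eq_bigr.
  by rewrite big_mkord big1// => j _; have := ltn_ord j; case: ifP => //; lia.
rewrite exchange_big /= !big_mkord; apply: eq_bigr => j _.
rewrite mulr_sumr [RHS](big_nat_widen _ _ K); last by have := ltn_ord j; lia.
rewrite [RHS]big_mkcond !big_mkord; apply: eq_bigr => i _ /=.
by rewrite ltn_subRL addnC mulrC; case: ifP.
Qed.

Lemma geom_sum n : (1 - beta) * \sum_(0 <= i < n) beta ^+ i = 1 - beta ^+ n.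
Proof. by rewrite big_mkord -opprB mulNr -subrX1 opprB. Qed.

Hypothesis hbeta_eq :
  (beta - \sum_(0 <= i < K.+1) beta ^+ i * PK K i Bad Bad)
    / (\sum_(0 <= i < K.+1) beta ^+ i * PK K i Good Bad)
  = (\sum_(0 <= i < K.+1) beta ^+ i * PK K i Bad Good)
    / (beta - \sum_(0 <= i < K.+1) beta ^+ i * PK K i Good Good).
Variables (a b g : R).
Hypothesis hA : matA p r K beta *m col3 a b g = col3 0 0 1.

Lemma matA_rows :
  [/\ (1 - PKtail p r K 1 Good Good) * a =
        (\sum_(0 <= i < K) beta ^+ i * PKtail p r K i.+1 Good Bad) * b +
        (\sum_(0 <= i < K.-1) beta ^+ i * PKtail p r K i.+2 Good Good) * g,
      b = PKtail p r K 1 Bad Good * a +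
          (\sum_(0 <= i < K) beta ^+ i * PKtail p r K i.+1 Bad Bad) * b +
          (\sum_(0 <= i < K.-1) beta ^+ i * PKtail p r K i.+2 Bad Good) * g &
      a + b / (1 - beta) + g / (1 - beta) = 1].
Proof.
have row i := congr1 (fun M : 'cV[R]_3 => M i ord0) hA.
have r0 := row ord0; have r1 := row (lift ord0 ord0).
have r2 := row (lift ord0 (lift ord0 ord0)).
move: r0 r1 r2; rewrite !mxE !big_ord_recl !big_ord0 !mxE /= => r0 r1 r2.
split; lra.
Qed.

Lemma char_det :
  (beta - genf Bad Bad) * (beta - genf Good Good) = genf Bad Good * genf Good Bad.
Proof.
have wn : beta - genf Good Good != 0 by rewrite gt_eqF// subr_gt0 genfGG_lt.
have zn : genf Good Bad != 0 by rewrite gt_eqF// genfGB_gt0.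
move/eqP: hbeta_eq; rewrite -!/(genf _ _) eqr_div// => /eqP ->.
by [].
Qed.

Let X s j := PK K j Good s + PK K j Bad s.

Lemma sum_X s : \sum_(0 <= j < K.+1) X s j = 1.
Proof.
rewrite -[RHS](path_mean_cst p r K 1 s) big_mkord; apply: eq_bigr => j _.
by rewrite big_bool !mulr1.
Qed.

Lemma X_Good0 : X Good 0 = 0.
Proof. by rewrite /X !PK_Good0 ?addr0//; lia. Qed.

Lemma sum_X_expr s : \sum_(0 <= j < K.+1) X s j * beta ^+ j = genf Good s + genf Bad s.
Proof.
by rewrite /genf -big_split; apply: eq_bigr => j _; rewrite /= -mulrDr mulrC.
Qed.

Lemma PKtail_X m s : PKtail p r K m Good s + PKtail p r K m Bad s = \sum_(m <= j < K.+1) X s j.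
Proof. by rewrite /PKtail -big_split. Qed.

(** Adding the first two rows of the system merges the end states, which expresses conservation of
    mass. Multiplication by [1 - beta] collapses the geometric sums into [genf]. *)
Lemma genf_balance :
  b * (genf Good Bad + genf Bad Bad - beta) +
  (g / beta) * (genf Good Good + genf Bad Good - beta) = 0.
Proof.
have [r0 r1 _] := matA_rows.
have bn0 : 1 - beta != 0 by rewrite gt_eqF// subr_gt0.
have bn : beta != 0 by rewrite gt_eqF.
have t1 : PKtail p r K 1 Good Good + PKtail p r K 1 Bad Good = 1.
  by rewrite PKtail_X -(sum_X Good) [RHS]big_ltn// X_Good0 add0r.
have tB : (1 - beta) *
    (\sum_(0 <= i < K) beta ^+ i * PKtail p r K i.+1 Good Bad +
     \sum_(0 <= i < K) beta ^+ i * PKtail p r K i.+1 Bad Bad) =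
    1 - (genf Good Bad + genf Bad Bad).
  rewrite -big_split /=.
  under eq_bigr do rewrite -mulrDr PKtail_X -[X in \sum_(X.+1 <= _ < _) _]addn0.
  rewrite -{1}(subn0 K) sum_tail mulr_sumr.
  under eq_bigr do rewrite subn0 mulrCA geom_sum mulrBr mulr1.
  by rewrite sumrB sum_X sum_X_expr.
have tG : (1 - beta) * beta *
    (\sum_(0 <= i < K.-1) beta ^+ i * PKtail p r K i.+2 Good Good +
     \sum_(0 <= i < K.-1) beta ^+ i * PKtail p r K i.+2 Bad Good) =
    beta - (genf Good Good + genf Bad Good).
  rewrite -big_split /=.
  under eq_bigr do rewrite -mulrDr PKtail_X -[X in \sum_(X.+1 <= _ < _) _]addn1.
  rewrite -subn1 sum_tail mulr_sumr.
  have -> : \sum_(0 <= i < K.+1) (1 - beta) * beta *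
       (X Good i * \sum_(0 <= i0 < i - 1) beta ^+ i0) =
      \sum_(0 <= i < K.+1) (X Good i * beta - X Good i * beta ^+ i).
    apply: eq_bigr => -[|i] _; first by rewrite X_Good0 !mul0r mulr0 subrr.
    rewrite subn1 /=; set S := \sum_(0 <= i0 < i) _.
    have -> : (1 - beta) * beta * (X Good i.+1 * S) = beta * X Good i.+1 * ((1 - beta) * S) by ring.
    by rewrite geom_sum exprS; ring.
  by rewrite sumrB -mulr_suml sum_X mul1r sum_X_expr.
have : (1 - beta) * (b * (genf Good Bad + genf Bad Bad - beta) +
  (g / beta) * (genf Good Good + genf Bad Good - beta)) = 0; last first.
  by move/eqP; rewrite mulf_eq0 (negPf bn0) => /eqP.
set S1 := \sum_(0 <= i < K) _ * _ in r0 tB; set S2 := \sum_(0 <= i < K) _ * _ in r1 tB.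
set S3 := \sum_(0 <= i < K.-1) _ * _ in r0 tG; set S4 := \sum_(0 <= i < K.-1) _ * _ in r1 tG.
have e : b = (S1 + S2) * b + (S3 + S4) * g.
  have T : PKtail p r K 1 Bad Good = 1 - PKtail p r K 1 Good Good by rewrite -t1 addrAC subrr add0r.
  by move: r1; rewrite T r0 => r1; rewrite {1}r1; ring.
have -> : genf Good Bad + genf Bad Bad = 1 - (1 - beta) * (S1 + S2) by rewrite tB; ring.
have -> : genf Good Good + genf Bad Good = beta - (1 - beta) * beta * (S3 + S4) by rewrite tG; ring.
rewrite (_ : _ * _ = (1 - beta) ^+ 2 * (b - ((S1 + S2) * b + (S3 + S4) * g))).
  by rewrite -e subrr mulr0.
by field.
Qed.

(** The equation for [beta] makes the two balance equations proportional, and [genf_balance] makes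
    their defects opposite. Both defects vanish unless [beta - BB = GB], the case that
    [genf_sum_neq] excludes. *)
Lemma genf_eigen (s' : bool) :
  b * genf s' Bad + (g / beta) * genf s' Good = beta * (if s' then g / beta else b).
Proof.
have bal := genf_balance; have det := char_det.
have w0 : 0 < beta - genf Good Good by rewrite subr_gt0 genfGG_lt.
have y0 := genfBG_gt0; have z0 := genfGB_gt0.
set g' := g / beta in bal *; set GB := genf Good Bad in bal det z0 *.
set BB := genf Bad Bad in bal det *; set BG := genf Bad Good in bal det y0 *.
set GG := genf Good Good in bal det w0 *.
have x0 : 0 < beta - BB by rewrite -(pmulr_lgt0 _ w0) det mulr_gt0.
have ne : beta - BB != GB.
  apply/eqP => e; apply: genf_sum_neq; rewrite -/GG -/GB -/BB -/BG; split; last by lra.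
  move: det; rewrite e mulrC => /(mulIf (lt0r_neq0 z0)); lra.
have e1 : b * (beta - BB) = g' * BG.
  have : (beta - BB - GB) * (b * (beta - BB) - g' * BG) = 0.
    have -> : (beta - BB - GB) * (b * (beta - BB) - g' * BG) =
       - (beta - BB) * (b * (GB + BB - beta) + g' * (GG + BG - beta))
       - g' * ((beta - BB) * (beta - GG) - BG * GB) by ring.
    by rewrite bal det subrr !mulr0 subrr.
  by move/eqP; rewrite mulf_eq0 !subr_eq0 (negPf ne) => /eqP.
by case: s'; rewrite -?/GB -?/GG -?/BB -?/BG; lra.
Qed.

(** The eigenvector equation makes [b] a positive multiple of [g], and then the first row makes [a]
    one; the normalisation forces [g] to be positive. *)
Lemma stat_pos : [/\ 0 < a, 0 < b & 0 < g].
Proof.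
have [r0 _ r2] := matA_rows.
have y0 := genfBG_gt0.
have x0 : 0 < beta - genf Bad Bad.
  have w0 : 0 < beta - genf Good Good by rewrite subr_gt0 genfGG_lt.
  by rewrite -(pmulr_lgt0 _ w0) char_det mulr_gt0// genfGB_gt0.
have tl_ge0 m s' s : 0 <= PKtail p r K m s' s by apply: sumr_ge0 => j _; exact: PKp_ge0.
have S1_ge0 : 0 <= \sum_(0 <= i < K) beta ^+ i * PKtail p r K i.+1 Good Bad.
  by apply: sumr_ge0 => i _; rewrite mulr_ge0// exprn_ge0// ltW.
have S3_gt0 : 0 < \sum_(0 <= i < K.-1) beta ^+ i * PKtail p r K i.+2 Good Good.
  rewrite big_ltn; last by rewrite -ltnS prednK// ltnW.
  rewrite expr0 mul1r; apply: ltr_pwDl; last first.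
    by apply: sumr_ge0 => i _; rewrite mulr_ge0// exprn_ge0// ltW.
  rewrite /PKtail big_nat_recr//=; apply: ltr_wpDl; last exact: PK_allG.
  by apply: sumr_ge0 => j _; exact: PKp_ge0.
have T1 : 0 < 1 - PKtail p r K 1 Good Good.
  rewrite -(sum_X Good) big_ltn// X_Good0 add0r -PKtail_X addrC addKr.
  rewrite /PKtail big_nat_recr/=; last exact: ltnW.
  apply: ltr_wpDl; first by apply: sumr_ge0 => j _; exact: PKp_ge0.
  by case: K hK => // k _; exact: PK_allG_Bad.
have e1 : b = g * (genf Bad Good / (beta * (beta - genf Bad Bad))).
  have := genf_eigen Bad => /= e.
  have bn : beta != 0 by rewrite gt_eqF.
  have xn : beta - genf Bad Bad != 0 by rewrite gt_eqF.
  apply: (mulIf xn).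
  have -> : g * (genf Bad Good / (beta * (beta - genf Bad Bad))) * (beta - genf Bad Bad)
     = g / beta * genf Bad Good by field; rewrite xn bn.
  by lra.
set k := (_ / _) in e1; have k0 : 0 < k by rewrite divr_gt0// mulr_gt0.
set S1 := \sum_(0 <= i < K) _ in r0 S1_ge0; set S3 := \sum_(0 <= i < K.-1) _ in r0 S3_gt0.
have e2 : a = g * ((S1 * k + S3) / (1 - PKtail p r K 1 Good Good)).
  have Tn := lt0r_neq0 T1; apply: (mulfI Tn); rewrite r0 e1; by field.
set l := (_ / _) in e2; have l0 : 0 < l.
  by rewrite divr_gt0// ltr_wpDl// mulr_ge0// ltW.
have g0 : 0 < g.
  have n0 : 0 < l + k / (1 - beta) + (1 - beta)^-1.
    have b1 : 0 < 1 - beta by rewrite subr_gt0.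
    by rewrite addr_gt0 ?invr_gt0// addr_gt0// divr_gt0.
  rewrite -(pmulr_lgt0 _ n0) (_ : _ * _ = a + b / (1 - beta) + g / (1 - beta)).
    by rewrite r2.
  by rewrite e2 e1; ring.
by split => //; rewrite ?e1 ?e2 mulr_gt0.
Qed.

Definition stat (n : nat) (s : bool) : R :=
  if s then (if n is n'.+1 then beta ^+ n' * g else a) else beta ^+ n * b.

Lemma stat_gt0 n s : 0 < stat n s.
Proof.
have [a0 b0 g0] := stat_pos.
by case: s n => -[|n] //=; rewrite mulr_gt0// exprn_gt0.
Qed.

End Stationary.

(** * The transition kernel seen by arrivals *)

Section Kernel.
Variables (R : realType) (p r : R) (K : nat).
Local Notation PK := (PK p r).

(* Transition operator and matrix of (queue length, channel state) seen by
   successive arrivals. *)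
Definition arr_op (f : nat -> bool -> R) n s :=
  path_mean p r K (fun j => f (n.+1 - j)%N) s.

Definition kern n s n' s' : R := \sum_(j < K.+1) PK K j s' s * ((n.+1 - j)%N == n')%:R.

(** At most K packets leave in a period, so level [n'] is entered only from levels below [n' + K],
    and finite sums express exact invariance. *)
Definition invariant (q : nat -> bool -> R) := forall n' s' N, (n' + K <= N)%N ->
  \sum_(n < N) \sum_(s : bool) q n s * kern n s n' s' = q n' s'.

Lemma kern_sum n s N (f : nat -> bool -> R) : (n.+1 < N)%N ->
  \sum_(n' < N) \sum_(s' : bool) kern n s n' s' * f n' s' = arr_op f n s.
Proof.
move=> nN; rewrite /arr_op /path_mean.
transitivity (\sum_(n' < N) \sum_(j < K.+1) \sum_(s' : bool)
    PK K j s' s * ((n.+1 - j)%N == n')%:R * f n' s').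
  apply: eq_bigr => n' _; rewrite exchange_big /=; apply: eq_bigr => s' _.
  by rewrite mulr_suml.
rewrite exchange_big /=; apply: eq_bigr => j _.
rewrite exchange_big /=; apply: eq_bigr => s' _.
have jN : (n.+1 - j < N)%N by lia.
rewrite (bigD1 (Ordinal jN))//= eqxx mulr1 big1 ?addr0// => i iN.
rewrite (_ : (_ == _) = false) ?mulr0 ?mul0r//.
by apply/negbTE; apply: contra iN => /eqP e; apply/eqP/val_inj.
Qed.

Lemma kern0 n s n' s' : (n' + K <= n)%N -> kern n s n' s' = 0.
Proof.
move=> nn'; apply: big1 => j _.
by rewrite (_ : (_ == _) = false) ?mulr0//; have := ltn_ord j; lia.
Qed.

Lemma arr_op_indic n s n' s' :
  arr_op (fun n1 s1 => ((n1 == n') && (s1 == s'))%:R) n s = kern n s n' s'.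
Proof.
rewrite /arr_op /path_mean /kern; apply: eq_bigr => j _.
rewrite big_bool; case: s' => /=; rewrite ?(andbF, andbT) mulr0 ?addr0 ?add0r//.
Qed.

Hypotheses (hp : 0 < p < 1) (hr : 0 < r < 1).

Lemma kern_ge0 n s n' s' : 0 <= kern n s n' s'.
Proof. by apply: sumr_ge0 => j _; apply: mulr_ge0 => //; exact: PKp_ge0. Qed.

Lemma kern_sum_le1 n s N :
  \sum_(n' < N) \sum_(s' : bool) kern n s n' s' <= 1.
Proof.
have := @kern_sum n s (N + n.+2) (fun _ _ => 1) ltac:(lia).
rewrite /arr_op path_mean_cst => <-.
under [X in _ <= X]eq_bigr do under eq_bigr do rewrite mulr1.
rewrite big_split_ord /= lerDl.
by apply: sumr_ge0 => i _; apply: sumr_ge0 => s' _; exact: kern_ge0.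
Qed.

Lemma kern_GG n : 0 < kern n Good (n.+1 - K)%N Good.
Proof.
rewrite /kern big_ord_recr /= eqxx mulr1 ltr_wpDl ?PK_allG//.
by apply: sumr_ge0 => j _; apply: mulr_ge0 => //; exact: PKp_ge0.
Qed.

Hypothesis hK : (2 <= K)%N.

Lemma kern_BG n : 0 < kern n Bad n.+1 Good.
Proof.
rewrite /kern big_ord_recl /= subn0 eqxx mulr1 ltr_pwDl//.
  by case: K hK => // k _; exact: PK_allB_Good.
by apply: sumr_ge0 => j _; apply: mulr_ge0 => //; exact: PKp_ge0.
Qed.

End Kernel.

Section StatInvariant.
Variables (R : realType) (p r : R) (K : nat) (beta a b g : R).
Hypotheses (hp : 0 < p < 1) (hr : 0 < r < 1) (hK : (2 <= K)%N).
Hypothesis hbeta : 0 < beta < 1.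
Hypothesis hbeta_eq :
  (beta - \sum_(0 <= i < K.+1) beta ^+ i * PK p r K i Bad Bad)
    / (\sum_(0 <= i < K.+1) beta ^+ i * PK p r K i Good Bad)
  = (\sum_(0 <= i < K.+1) beta ^+ i * PK p r K i Bad Good)
    / (beta - \sum_(0 <= i < K.+1) beta ^+ i * PK p r K i Good Good).
Hypothesis hA : matA p r K beta *m col3 a b g = col3 0 0 1.

(** At level 0 balance is the first two rows of the linear system; at level [n'.+1] it is
    [beta ^+ n'] times the identity of [genf_eigen]. *)
Lemma stat_invariant : invariant p r K (stat beta a b g).
Proof.
have bn : beta != 0 by rewrite gt_eqF//; case/andP: hbeta.
have [r0 r1 _] := matA_rows hA.
move=> [|n'] s' N nN.
  have tl s : \sum_(n < N) stat beta a b g n s * kern p r K n s 0 s' =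
      \sum_(0 <= n < K) stat beta a b g n s * PKtail p r K n.+1 s' s.
    rewrite -(big_mkord xpredT (fun n => stat beta a b g n s * kern p r K n s 0 s')).
    rewrite (big_cat_nat _ (n := K))//= [X in _ + X]big1_seq ?addr0; last first.
      by move=> i /andP[_]; rewrite mem_index_iota => /andP[Ki _]; rewrite kern0 ?mulr0.
    apply: eq_big_nat => n /andP[_ nK]; congr (_ * _).
    rewrite /PKtail (big_nat_widenl _ 0)// big_mkcond big_mkord; apply: eq_bigr => j _ /=.
    by rewrite subn_eq0; case: ifP; rewrite ?mulr1 ?mulr0.
  rewrite exchange_big sum_bool !tl [X in X + _]big_ltn /=; last by lia.
  rewrite (big_addn 0 _ 1) /= subn1.
  have -> : \sum_(0 <= i < K.-1) stat beta a b g (i + 1) true * PKtail p r K (i + 1).+1 s' true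
     = (\sum_(0 <= i < K.-1) beta ^+ i * PKtail p r K i.+2 s' Good) * g.
    by rewrite mulr_suml; apply: eq_bigr => i _; rewrite addn1 /= mulrAC.
  have -> : \sum_(0 <= i < K) beta ^+ i * b * PKtail p r K i.+1 s' false
     = (\sum_(0 <= i < K) beta ^+ i * PKtail p r K i.+1 s' Bad) * b.
    by rewrite mulr_suml; apply: eq_bigr => i _; rewrite mulrAC.
  by case: s' {tl} => /=; rewrite ?expr0; lra.
have tl s : \sum_(n < N) stat beta a b g n s * kern p r K n s n'.+1 s' =
    \sum_(j < K.+1) PK p r K j s' s * stat beta a b g (n' + j) s.
  under eq_bigr do rewrite /kern mulr_sumr.
  rewrite exchange_big /=; apply: eq_bigr => j _.
  have jN : (n' + j < N)%N by have := ltn_ord j; lia.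
  rewrite (bigD1 (Ordinal jN))//= -addSn addnK eqxx mulr1 mulrC big1 ?addr0// => i iN.
  rewrite (_ : (_ == _) = false) ?mulr0//.
  apply/negbTE; apply: contra iN => /eqP e; apply/eqP/val_inj => /=; lia.
have eig := genf_eigen hp hr hK hbeta hbeta_eq hA s'.
rewrite exchange_big sum_bool !tl.
have -> : \sum_(j < K.+1) PK p r K j s' true * stat beta a b g (n' + j) true =
    beta ^+ n' * (g / beta * genf p r K beta s' Good).
  rewrite /genf big_mkord !mulr_sumr; apply: eq_bigr => -[[|j] jK] _ /=.
    by rewrite PK_Good0 ?mul0r ?mulr0//; lia.
  by rewrite addnS exprD exprS; field.
have -> : \sum_(j < K.+1) PK p r K j s' false * stat beta a b g (n' + j) false =
    beta ^+ n' * (b * genf p r K beta s' Bad).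
  by rewrite /genf big_mkord !mulr_sumr; apply: eq_bigr => j _ /=; rewrite exprD; ring.
rewrite -mulrDr addrC eig; case: s' {tl eig} => /=; last by rewrite exprS; ring.
by field.
Qed.

End StatInvariant.

(** * Uniqueness of the invariant measure *)

Section Uniqueness.
Variables (R : realType) (p r : R) (K : nat).
Hypotheses (hp : 0 < p < 1) (hr : 0 < r < 1) (hK : (2 <= K)%N).
Local Notation kern := (kern p r K).

Definition mass (q : nat -> bool -> R) N := \sum_(n < N) \sum_(s : bool) q n s.

Lemma kern_widen (q : nat -> bool -> R) n' s' N : (n' + K <= N)%N ->
  \sum_(n < N) \sum_(s : bool) q n s * kern n s n' s' =
  \sum_(n < n' + K) \sum_(s : bool) q n s * kern n s n' s'.
Proof.
move=> nN; rewrite -(subnKC nN) big_split_ord /= [X in _ + X]big1 ?addr0// => i _.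
by apply: big1 => s _; rewrite kern0 ?mulr0// leq_addr.
Qed.

Lemma mass_kern (q : nat -> bool -> R) N M : (forall n s, 0 <= q n s) ->
  \sum_(n' < M) \sum_(s' : bool) \sum_(n < N) \sum_(s : bool) q n s * kern n s n' s'
  <= mass q N.
Proof.
move=> q0.
rewrite (_ : \sum_(n' < M) _ = \sum_(n < N) \sum_(s : bool) q n s *
    \sum_(n' < M) \sum_(s' : bool) kern n s n' s').
  apply: ler_sum => n _; apply: ler_sum => s _.
  by rewrite ler_piMr// kern_sum_le1.
under eq_bigr do rewrite exchange_big.
rewrite exchange_big /=; apply: eq_bigr => n _.
under eq_bigr do rewrite exchange_big.
rewrite exchange_big /=; apply: eq_bigr => s _.
by rewrite mulr_sumr; apply: eq_bigr => n' _; rewrite mulr_sumr.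
Qed.

(* A subinvariant measure of finite mass is invariant: any defect at one point
   would be collected again by every block of K levels. *)
Lemma subinvariant_invariant (q : nat -> bool -> R) B :
  (forall n s, 0 <= q n s) -> (forall N, mass q N <= B) ->
  (forall n' s', q n' s' <=
     \sum_(n < n' + K) \sum_(s : bool) q n s * kern n s n' s') ->
  invariant p r K q.
Proof.
move=> q0 qB sub n' s' N nN; rewrite kern_widen//.
apply/eqP; rewrite eq_le sub andbT leNgt -subr_gt0; apply/negP => d0.
set d := _ - _ in d0.
pose D n1 s1 := \sum_(n < n1 + K) \sum_(s : bool) q n s * kern n s n1 s1 - q n1 s1.
have D0 n1 s1 : 0 <= D n1 s1 by rewrite subr_ge0.
(* The inflow into the levels below [M] comes from the levels below [M + K] and is at most their
   mass, so the defects below [M] are paid for by the block of K levels starting at [M]. *)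
have stp M : (n' < M)%N -> d <= mass q (M + K) - mass q M.
  move=> nM; rewrite (@le_trans _ _ (mass D M))//.
    rewrite /mass (bigD1 (Ordinal nM))//= (bigD1 s')//= -addrA lerDl.
    by apply: addr_ge0; apply: sumr_ge0 => n _ //; apply: sumr_ge0.
  rewrite /mass /D; under eq_bigr do rewrite sumrB.
  rewrite sumrB lerB// -/(mass q (M + K)); apply: le_trans (mass_kern (M + K) M q0).
  apply: ler_sum => n1 _; apply: ler_sum => s1 _.
  by rewrite [X in _ <= X]kern_widen// leq_add2r ltnW.
have acc i : i%:R * d <= mass q (n'.+1 + i * K).
  elim: i => [|i IH]; first by rewrite mul0r; apply: sumr_ge0 => n _; exact: sumr_ge0.
  have := stp (n'.+1 + i * K)%N ltac:(lia).
  rewrite -addnA -mulSnr -natr1 mulrDl mul1r; lra.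
have B0 : 0 <= B by apply: le_trans (qB 0%N); rewrite /mass big_ord0.
have /archi_boundP : 0 <= B / d by rewrite divr_ge0// ltW.
rewrite ltr_pdivrMr//; apply/negP; rewrite -leNgt.
exact: le_trans (acc _) (qB _).
Qed.

(** Zeros propagate backwards along positive transitions. An all-good period lowers every positive
    level, so all good states are reached from level 0; an all-bad period followed by Good raises
    the level by one, which settles the bad states. *)
Lemma invariant_null (q : nat -> bool -> R) :
  (forall n s, 0 <= q n s) -> invariant p r K q -> q 0%N Good = 0 ->
  forall n s, q n s = 0.
Proof.
move=> q0 inv q00.
have back n s n' s' : 0 < kern n s n' s' -> q n' s' = 0 -> q n s = 0.
  move=> k0; rewrite -(inv n' s' (maxn n.+1 (n' + K))); last exact: leq_maxr.
  have nN : (n < maxn n.+1 (n' + K))%N by exact: leq_maxl.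
  rewrite (bigD1 (Ordinal nN))//= (bigD1 s)//= -addrA => /eqP.
  rewrite paddr_eq0.
  - by case/andP; rewrite mulf_eq0 (gt_eqF k0) orbF => /eqP.
  - by apply: mulr_ge0 => //; exact: kern_ge0.
  - apply: addr_ge0; apply: sumr_ge0 => i _; first by apply: mulr_ge0 => //; exact: kern_ge0.
    by apply: sumr_ge0 => s1 _; apply: mulr_ge0 => //; exact: kern_ge0.
have qG n : q n Good = 0.
  elim/ltn_ind: n => -[|n] IH //.
  by apply: (back _ _ _ _ (kern_GG K hp hr n.+1)); apply: IH; lia.
move=> n [] //; exact: (back _ _ _ _ (kern_BG hp hr hK n)).
Qed.

(** By the triangle inequality the absolute difference is subinvariant, hence invariant; the choice
    of the ratio makes it vanish at level 0 in state Good. *)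
Lemma invariant_unique (q pi : nat -> bool -> R) :
  (forall n s, 0 <= q n s) -> (forall n s, 0 < pi n s) ->
  (forall N, mass q N <= 1) -> (forall N, mass pi N <= 1) ->
  invariant p r K q -> invariant p r K pi ->
  forall n s, q n s = q 0%N Good / pi 0%N Good * pi n s.
Proof.
move=> q0 pi0 q1 pi1 qI piI n s; set c := _ / _.
have c0 : 0 <= c by rewrite divr_ge0// ltW.
pose nu n s := `|q n s - c * pi n s|.
suff: nu n s = 0 by move/eqP; rewrite normr_eq0 subr_eq0 => /eqP.
have nu0 n1 s1 : 0 <= nu n1 s1 by exact: normr_ge0.
apply: invariant_null => [//||]; last first.
  by rewrite /nu /c divfK ?subrr ?normr0// gt_eqF.
apply: (@subinvariant_invariant _ (1 + c)) => [//|N|n' s'].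
  apply: (@le_trans _ _ (mass q N + c * mass pi N)); last first.
    by rewrite lerD// ler_piMr.
  rewrite /mass mulr_sumr -big_split /=; apply: ler_sum => i _.
  rewrite mulr_sumr -big_split /=; apply: ler_sum => s1 _.
  rewrite (le_trans (ler_normB _ _))// lerD// ger0_norm//.
  by rewrite mulr_ge0// ltW.
rewrite /nu -(qI n' s' _ (leqnn _)) -(piI n' s' _ (leqnn _)) mulr_sumr -sumrB.
rewrite (le_trans (ler_norm_sum _ _ _))//; apply: ler_sum => i _.
rewrite mulr_sumr -sumrB.
rewrite (le_trans (ler_norm_sum _ _ _))//; apply: ler_sum => s1 _.
by rewrite mulrA -mulrBl normrM (ger0_norm (kern_ge0 _ hp hr _ _ _ _)).
Qed.

End Uniqueness.

(** * Geometric sums with polynomial weights *)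

Section GeometricSums.
Variables (R : realType) (beta : R).
Hypothesis hbeta : 0 < beta < 1.

Let beta0 : 0 < beta. Proof. by case/andP: hbeta. Qed.
Let beta1 : beta < 1. Proof. by case/andP: hbeta. Qed.

Lemma poly4_geom_le : exists C gamma : R,
  [/\ 0 <= C, 0 < gamma < 1 & forall n, n.+1%:R ^+ 4 * beta ^+ n <= C * gamma ^+ n].
Proof.
(* The fraction 1/8 makes [(1 + h) ^+ 4 * (1 - 8 * h)] less than 1, while [h * n.+1 <= (1 + h) ^+ n]
   trades the polynomial factor for this larger ratio. *)
have [h [h0 h1 bh]] : exists h : R, [/\ 0 < h, 8 * h < 1 & beta = 1 - 8 * h].
  exists ((1 - beta) / 8); split; last by lra.
    by rewrite divr_gt0// subr_gt0.
  by have := beta0; lra.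
have bern n : h * n.+1%:R <= (1 + h) ^+ n.
  elim: n => [|n IH]; first by rewrite expr0; lra.
  have : 1 <= (1 + h) ^+ n by rewrite exprn_ege1//; lra.
  by rewrite -natr1 exprS mulrDl mul1r; nra.
exists (h ^- 4), ((1 + h) ^+ 4 * beta); split.
- by rewrite invr_ge0 exprn_ge0// ltW.
- apply/andP; split; first by rewrite mulr_gt0// exprn_gt0//; lra.
  have -> : (1 + h) ^+ 4 * beta =
    1 - (4 * h + 26 * h ^+ 2 + 44 * h ^+ 3 + 31 * h ^+ 4 + 8 * h ^+ 5).
    by rewrite bh; ring.
  by rewrite ltrBlDr ltrDl !addr_gt0// mulr_gt0// exprn_gt0.
move=> n; rewrite exprMn mulrA ler_wpM2r// ?exprn_ge0 ?(ltW beta0)//.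
rewrite -exprM mulnC exprM ler_pdivlMl ?exprn_gt0// -exprMn.
by rewrite lerXn2r// nnegrE ?mulr_ge0 ?exprn_ge0//; lra.
Qed.

Lemma cvg_poly2_geom : n.+1%:R ^+ 2 * beta ^+ n @[n --> \oo] --> (0 : R).
Proof.
have [C [gamma [C0 /andP[g0 g1] le]]] := poly4_geom_le.
apply: (@squeeze_cvgr _ _ _ _ (fun=> 0) (fun n => C * gamma ^+ n)).
- apply: nearW => n; rewrite mulr_ge0 ?exprn_ge0 ?(ltW beta0)//=.
  apply: le_trans (le n); rewrite ler_wpM2r// ?exprn_ge0 ?(ltW beta0)//.
  by rewrite ler_weXn2l// ler1n.
- exact: cvg_cst.
- rewrite -(mulr0 C); apply: cvgMr; apply: cvg_expr.
  by rewrite ger0_norm// ltW.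
Qed.

Lemma cvg_geom_affine (u v : R) :
  \sum_(n < N) beta ^+ n * (u + v * n%:R) @[N --> \oo] -->
  u / (1 - beta) + v * beta / (1 - beta) ^+ 2.
Proof.
set A := _ + _.
have bn : 1 - beta != 0 by rewrite gt_eqF// subr_gt0.
have E N : \sum_(n < N) beta ^+ n * (u + v * n%:R) =
    A - (A * beta ^+ N + v / (1 - beta) * (N%:R * beta ^+ N)).
  elim: N => [|N IH]; first by rewrite big_ord0 expr0; ring.
  by rewrite big_ord_recr /= IH -natr1 exprS /A; field.
rewrite (_ : (fun N => _) = fun N => A - (A * beta ^+ N + v / (1 - beta) * (N%:R * beta ^+ N))).
  2: by apply/funext => N.
have -> : nbhs A = nbhs (A - (A * 0 + v / (1 - beta) * 0)) by rewrite !mulr0 addr0 subr0.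
have small N : 0 <= N%:R * beta ^+ N <= N.+1%:R ^+ 2 * beta ^+ N.
  rewrite mulr_ge0 ?exprn_ge0 ?(ltW beta0)//= ler_wpM2r// ?exprn_ge0 ?(ltW beta0)//.
  by rewrite (@le_trans _ _ N.+1%:R) ?ler_nat// expr2 ler_peMl// ler1n.
apply: cvgB; first exact: cvg_cst.
apply: cvgD; apply: cvgMr.
  by apply: cvg_expr; rewrite ger0_norm// ltW.
apply: (squeeze_cvgr _ (cvg_cst 0) cvg_poly2_geom).
by apply: nearW => N; exact: small.
Qed.

End GeometricSums.

(** * Potentials and their drifts *)

Section LinearFunctionals.
Variable R : realType.

Definition indic (n' : nat) (s' : bool) (n : nat) (s : bool) : R :=
  ((n == n') && (s == s'))%:R.

Variables (A : nat -> (nat -> bool -> R) -> R) (pi : nat -> bool -> R).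
Context (F : set_system nat) {FF : Filter F}.
Hypothesis A_lin : forall N c f h,
  A N (fun n s => c * f n s + h n s) = c * A N f + A N h.
Hypothesis A_ind : forall n s, A N (indic n s) @[N --> F] --> pi n s.

Let A0 N : A N (fun _ _ => 0) = 0.
Proof.
have := A_lin N 1 (fun _ _ => 0) (fun _ _ => 0).
have -> : (fun (_ : nat) (_ : bool) => 1 * 0 + 0 : R) = fun _ _ => 0.
  by apply/funext => n; apply/funext => s; ring.
by move=> e; lra.
Qed.

(** The top level is peeled off as a combination of two indicators. The filter is arbitrary, to
    cover limits at infinity and along ultrafilters. *)
Lemma functional_cvg_finite (J : nat -> bool -> R) M :
  (forall n s, (M <= n)%N -> J n s = 0) ->
  A N J @[N --> F] --> \sum_(n < M) \sum_(s : bool) pi n s * J n s.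
Proof.
elim: M J => [|M IH] J JM.
  rewrite big_ord0 (_ : A^~ J = fun=> 0); first exact: cvg_cst.
  apply/funext => N; rewrite -[RHS](A0 N); congr (A N _).
  by apply/funext => n; apply/funext => s; rewrite JM.
pose J' n s := if n == M then 0 else J n s.
have -> : A^~ J = fun N => J M true * A N (indic M true) +
    (J M false * A N (indic M false) + A N J').
  apply/funext => N; rewrite -!A_lin; congr (A N _).
  apply/funext => n; apply/funext => s; rewrite /J' /indic.
  by case: eqP => [->|_]; case: s; rewrite /= ?mulr0 ?mulr1 ?add0r ?addr0.
rewrite big_ord_recr /= sum_bool addrC -addrA.
have -> : \sum_(n < M) \sum_s pi n s * J n s = \sum_(n < M) \sum_s pi n s * J' n s.
  apply: eq_bigr => n _; apply: eq_bigr => s _; rewrite /J'.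
  by rewrite ltn_eqF.
apply: cvgD; first by rewrite mulrC; apply: cvgMr; exact: A_ind.
apply: cvgD; first by rewrite mulrC; apply: cvgMr; exact: A_ind.
apply: IH => n s Mn; rewrite /J'; case: eqP => // nM; rewrite JM//; lia.
Qed.

End LinearFunctionals.

Section Potentials.
Variables (R : realType) (p r : R) (K : nat).
Hypotheses (hp : 0 < p < 1) (hr : 0 < r < 1).
Local Notation tr := (Defs.ge_trans p r).
Local Notation arr_op := (arr_op p r K).

Let p0 : 0 < p. Proof. by case/andP: hp. Qed.
Let r0 : 0 < r. Proof. by case/andP: hr. Qed.
Let pr0 : p + r != 0. Proof. by rewrite gt_eqF// addr_gt0. Qed.
Let rn0 : r != 0. Proof. by rewrite gt_eqF. Qed.

(* One slot without arrivals. *)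
Definition serve_op (f : nat -> bool -> R) n (s : bool) : R :=
  \sum_(s1 : bool) tr s s1 * f (n - s)%N s1.

(** Truncated subtractions compose, so service slot by slot, idle slots included, depends only on
    the number of good slots. *)
Lemma path_mean_serve k f n s :
  path_mean p r k (fun j => f (n - j)%N) s = iter k serve_op f n s.
Proof.
elim: k n s => [|k IH] n s; first by rewrite path_mean0 subn0.
rewrite path_meanS /=; apply: eq_bigr => s1 _; rewrite -IH; congr (_ * _).
by apply: eq_path_mean => j s' _; rewrite subnDA.
Qed.

Lemma arr_op_serve f n s : arr_op f n s = iter K serve_op f n.+1 s.
Proof. exact: path_mean_serve. Qed.

Definition service_rate : R := r / (p + r).
Local Notation mu := service_rate.

Let mu0 : 0 < mu. Proof. by rewrite divr_gt0// addr_gt0. Qed.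

(* The correction by the channel state makes the drift state-independent. *)
Definition lin_pot (n : nat) (s : bool) : R := n%:R - (p + r)^-1 * s%:R.

(** With [k <= n] truncation never acts, and each slot lowers the potential by the mean service
    rate. *)
Lemma iter_serve_lin k n s : (k <= n)%N ->
  iter k serve_op lin_pot n s = lin_pot n s - k%:R * mu.
Proof.
elim: k n s => [|k IH] n s kn; first by rewrite mul0r subr0.
rewrite /= /serve_op sum_bool !IH; try by case: s => /=; lia.
rewrite /lin_pot natrB; last by case: s => /=; lia.
by rewrite -natr1 /mu; case: s => /=; field.
Qed.

Lemma arr_op_lin n s : (K <= n.+1)%N ->
  arr_op lin_pot n s = lin_pot n s + (1 - K%:R * mu).
Proof.
by move=> Kn; rewrite arr_op_serve iter_serve_lin// /lin_pot -natr1; ring.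
Qed.

(* Expected number of slots needed to deliver i + 1 packets, starting in s. *)
Definition sojourn (i : nat) (s : bool) : R :=
  1 + i%:R * mu^-1 + (~~ s)%:R * r^-1.

(* Total remaining expected sojourn time of n queued packets. *)
Definition quad_pot (n : nat) (s : bool) : R := \sum_(i < n) sojourn i s.

Lemma quad_potS n s : quad_pot n.+1 s = quad_pot n s + sojourn n s.
Proof. by rewrite /quad_pot big_ord_recr. Qed.

(** Each queued packet loses one slot of its expected remaining sojourn; the identity is exact also
    when the queue empties. *)
Lemma serve_quad n s : serve_op quad_pot n s = quad_pot n s - n%:R.
Proof.
rewrite /serve_op sum_bool; case: s => /=; last first.
  rewrite subn0; elim: n => [|n IH]; first by rewrite /quad_pot !big_ord0; ring.
  rewrite !quad_potS -natr1.
  have -> : r * (quad_pot n true + sojourn n true) +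
     (1 - r) * (quad_pot n false + sojourn n false) =
     r * quad_pot n true + (1 - r) * quad_pot n false + sojourn n false - 1.
    by rewrite /sojourn /=; field; rewrite rn0 lt0r_neq0.
  by rewrite IH; ring.
case: n => [|n]; first by rewrite /quad_pot !big_ord0; ring.
rewrite subn1 /=; elim: n => [|n IH].
  by rewrite /quad_pot !big_ord0 big_ord1 /sojourn /=; ring.
rewrite [quad_pot n.+2 _]quad_potS [quad_pot n.+1 _ in LHS]quad_potS.
rewrite [quad_pot n.+1 false]quad_potS.
have -> : (1 - p) * (quad_pot n true + sojourn n true) +
   p * (quad_pot n false + sojourn n false) =
   (1 - p) * quad_pot n true + p * quad_pot n false + sojourn n.+1 true - 1.
  by rewrite /sojourn /mu -natr1 /=; field; rewrite rn0 pr0.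
by rewrite IH -[n.+2%:R]natr1; ring.
Qed.

(** As long as the queue cannot run dry, the packets served within [k] slots do not depend on its
    length, so the correction to [k * n] is a function of the channel state. *)
Lemma iter_serve_quad k : exists e : bool -> R, forall n s, (k <= n)%N ->
  iter k serve_op quad_pot n s = quad_pot n s - k%:R * n%:R + e s.
Proof.
elim: k => [|k [e IH]]; first by exists (fun=> 0) => n s _ /=; ring.
exists (fun s : bool => k%:R * s%:R + \sum_(s1 : bool) tr s s1 * e s1) => n s kn.
rewrite /= /serve_op sum_bool !IH; try by case: s => /=; lia.
have := serve_quad n s; rewrite /serve_op !sum_bool.
rewrite natrB; last by case: s => /=; lia.
have := tr_sum1 p r s; rewrite sum_bool => t1 h.
have -> : tr s false = 1 - tr s true by rewrite -t1 addrAC subrr add0r.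
move: h; have -> : tr s false = 1 - tr s true by rewrite -t1 addrAC subrr add0r.
move=> h; rewrite -natr1.
set A := quad_pot (n - s)%N true in h *; set B := quad_pot (n - s)%N false in h *.
rewrite (_ : quad_pot n s = n%:R + (tr s true * A + (1 - tr s true) * B)); last first.
  by rewrite h; ring.
by ring.
Qed.

Lemma arr_op_quad : exists e : bool -> R, forall n s, (K <= n.+1)%N ->
  arr_op quad_pot n s = quad_pot n s - (K%:R - mu^-1) * n%:R + e s.
Proof.
have [e He] := iter_serve_quad K.
exists (fun s => e s + 1 + (~~ s)%:R * r^-1 - K%:R) => n s Kn.
by rewrite arr_op_serve He// quad_potS /sojourn -natr1; ring.
Qed.

Hypothesis hK : (2 <= K)%N.

Definition bad_ind (n : nat) (s : bool) : R := (~~ s)%:R.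

(** Bad is reachable from Good, hence the strict inequality. It makes the coefficient of [bad_ind]
    in its own drift nonzero, so that a vanishing average drift determines the frequency of Bad. *)
Lemma arr_op_bad : exists2 w : bool -> R, w Bad < 1 + w Good &
  forall n s, arr_op bad_ind n s = w s.
Proof.
exists (path_mean p r K (fun _ s' => (~~ s')%:R)) => //.
have wG : 0 < path_mean p r K (fun _ s' => (~~ s')%:R) Good.
  apply: (@path_mean_gt0 _ p r K _ _ ord_max Bad) => [j s' _|].
    by apply: mulr_ge0 => //; exact: PKp_ge0.
  by rewrite mulr1; case: K hK => // k _; exact: PK_allG_Bad.
have wB : path_mean p r K (fun _ s' => (~~ s')%:R) Bad <= 1.
  rewrite -[X in _ <= X](path_mean_cst p r K 1 Bad).
  apply: ler_sum => j _; apply: ler_sum => s' _.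
  by apply: ler_wpM2l; [exact: PKp_ge0|rewrite lern1 leq_b1].
lra.
Qed.

Hypothesis hstab : K%:R^-1 < r / (p + r).

Lemma stable_drift : 0 < K%:R * mu - 1.
Proof.
have K0 : 0 < K%:R :> R by rewrite ltr0n; lia.
by move: hstab; rewrite subr_gt0 -(ltr_pM2l K0) mulfV// gt_eqF.
Qed.

Definition drift (f : nat -> bool -> R) n s := arr_op f n s - f n s.

(* A is meant to be an empirical average or a truncated mean under pi. *)
Lemma sojourn_limit (pi : nat -> bool -> R) : exists V : R,
  forall A : nat -> (nat -> bool -> R) -> R,
  (forall N c f h, A N (fun n s => c * f n s + h n s) = c * A N f + A N h) ->
  (forall n s, A N (indic R n s) @[N --> \oo] --> pi n s) ->
  A N (fun _ _ => 1) @[N --> \oo] --> (1 : R) ->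
  A N (drift quad_pot) @[N --> \oo] --> (0 : R) ->
  A N (drift bad_ind) @[N --> \oo] --> (0 : R) ->
  A N sojourn @[N --> \oo] --> V.
Proof.
have [e He] := arr_op_quad; have [w w0 Hw] := arr_op_bad.
(* The deviation of the drift of [quad_pot] from its affine form lives on the levels below K, so its
   average is known from [pi]. *)
pose J n s := drift quad_pot n s + (K%:R - mu^-1) * n%:R - e s.
have J0 n s : (K <= n)%N -> J n s = 0.
  by move=> Kn; rewrite /J /drift He; [ring|lia].
pose W := 1 + w Good - w Bad.
have W0 : W != 0 by rewrite gt_eqF// subr_gt0.
pose k := K%:R - mu^-1.
have k0 : k != 0.
  rewrite gt_eqF// -(pmulr_lgt0 _ mu0) mulrBl mulVf ?gt_eqF//; exact: stable_drift.
(* [LB] and [Ln] are the frequency of Bad and the mean level forced by vanishing drifts. They depend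
   on [pi] but not on [A], so every admissible [A] gets the same limit. *)
pose LB := W^-1 * w Good.
pose Ln := k^-1 * (\sum_(n < K) \sum_(s : bool) pi n s * J n s +
   (e Good + (e Bad - e Good) * LB)).
exists (1 + (mu^-1 * Ln + r^-1 * LB)) => A A_lin A_ind A1 Aq Ab.
have A00 N : A N (fun _ _ => 0) = 0.
  have := A_lin N 1 (fun _ _ => 0) (fun _ _ => 0).
  have -> : (fun (_ : nat) (_ : bool) => 1 * 0 + 0 : R) = fun _ _ => 0.
    by apply/funext => n; apply/funext => s; ring.
  by move=> ?; lra.
have A_comb2 N c1 f1 c2 f2 : A N (fun n s => c1 * f1 n s + c2 * f2 n s) = c1 * A N f1 + c2 * A N f2.
  rewrite A_lin; congr (_ + _).
  rewrite -[RHS]addr0 -(A00 N) -A_lin; congr (A N _).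
  by apply/funext => n; apply/funext => s; rewrite addr0.
have cB : A N bad_ind @[N --> \oo] --> LB.
  have -> : A^~ bad_ind = fun N =>
      W^-1 * (w Good * A N (fun _ _ => 1) + (-1) * A N (drift bad_ind)).
    apply/funext => N; rewrite -A_comb2 -[RHS]addr0 -(A00 N) -A_lin; congr (A N _).
    apply/funext => n; apply/funext => s; rewrite /drift Hw /bad_ind addr0 /W.
    by case: s => /=; field.
  have -> : nbhs LB = nbhs (W^-1 * (w Good * 1 + -1 * 0)) by rewrite mulr1 mulr0 addr0.
  by apply: cvgMr; apply: cvgD; apply: cvgMr.
have cJ : A N J @[N --> \oo] --> \sum_(n < K) \sum_(s : bool) pi n s * J n s.
  exact: functional_cvg_finite.
have ce : A N (fun _ => e) @[N --> \oo] --> e Good + (e Bad - e Good) * LB.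
  have -> : A^~ (fun _ => e) = fun N =>
      e Good * A N (fun _ _ => 1) + (e Bad - e Good) * A N bad_ind.
    apply/funext => N; rewrite -A_comb2; congr (A N _).
    by apply/funext => n; apply/funext => s; rewrite /bad_ind; case: s => /=; ring.
  have -> : nbhs (e Good + (e Bad - e Good) * LB) =
    nbhs (e Good * 1 + (e Bad - e Good) * LB) by rewrite mulr1.
  by apply: cvgD; apply: cvgMr.
have cn : A N (fun n _ => n%:R) @[N --> \oo] --> Ln.
  have -> : A^~ (fun n _ => n%:R) = fun N => k^-1 *
      (A N J + A N (fun _ => e) + (-1) * A N (drift quad_pot)).
    apply/funext => N; rewrite -[X in X + _ + _]mul1r -A_lin -[X in X + _]mul1r -A_comb2.
    rewrite -[RHS]addr0 -(A00 N) -A_lin; congr (A N _).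
    by apply/funext => n; apply/funext => s; rewrite /J -/k; field.
  have -> : nbhs Ln = nbhs (k^-1 * (\sum_(n < K) \sum_(s : bool) pi n s * J n s +
     (e Good + (e Bad - e Good) * LB) + -1 * 0)) by rewrite mulr0 addr0.
  by apply: cvgMr; apply: cvgD; [exact: cvgD|exact: cvgMr].
have -> : A^~ sojourn = fun N => A N (fun _ _ => 1) +
    (mu^-1 * A N (fun n _ => n%:R) + r^-1 * A N bad_ind).
  apply/funext => N; rewrite -A_comb2 -[X in X + _]mul1r -A_lin; congr (A N _).
  by apply/funext => n; apply/funext => s; rewrite /sojourn /bad_ind; ring.
by apply: cvgD => //; apply: cvgD; apply: cvgMr.
Qed.

End Potentials.

(** * Means under the invariant probability *)

Section StatLimits.
Variables (R : realType) (p r : R) (K : nat) (beta a b g : R).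
Hypotheses (hp : 0 < p < 1) (hr : 0 < r < 1) (hK : (2 <= K)%N).
Hypothesis hbeta : 0 < beta < 1.
Hypothesis hbeta_eq :
  (beta - \sum_(0 <= i < K.+1) beta ^+ i * PK p r K i Bad Bad)
    / (\sum_(0 <= i < K.+1) beta ^+ i * PK p r K i Good Bad)
  = (\sum_(0 <= i < K.+1) beta ^+ i * PK p r K i Bad Good)
    / (beta - \sum_(0 <= i < K.+1) beta ^+ i * PK p r K i Good Good).
Hypothesis hA : matA p r K beta *m col3 a b g = col3 0 0 1.
Local Notation stat := (stat beta a b g).
Local Notation mu := (service_rate p r).
Local Notation kern := (kern p r K).
Local Notation arr_op := (arr_op p r K).
Local Notation drift := (drift p r K).

Let beta0 : 0 < beta. Proof. by case/andP: hbeta. Qed.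
Let beta1 : beta < 1. Proof. by case/andP: hbeta. Qed.

Let stat0 n s : 0 < stat n s.
Proof. exact: (stat_gt0 hp hr hK hbeta hbeta_eq hA). Qed.

Let statI : invariant p r K stat.
Proof. exact: stat_invariant. Qed.

Definition stat_mean N (f : nat -> bool -> R) :=
  \sum_(n < N) \sum_(s : bool) stat n s * f n s.

Lemma stat_mean_lin N c f h :
  stat_mean N (fun n s => c * f n s + h n s) = c * stat_mean N f + stat_mean N h.
Proof.
rewrite /stat_mean mulr_sumr -big_split; apply: eq_bigr => n _.
rewrite mulr_sumr -big_split; apply: eq_bigr => s _ /=; ring.
Qed.

Lemma stat_mean_affine (u : bool -> R) v :
  stat_mean N (fun n s => u s + v * n%:R) @[N --> \oo] -->
  u Good * a + (u Bad / (1 - beta) + v * beta / (1 - beta) ^+ 2) * b +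
  ((u Good + v) / (1 - beta) + v * beta / (1 - beta) ^+ 2) * g.
Proof.
pose S w N := \sum_(n < N) beta ^+ n * (w + v * n%:R).
(* Geometric decay of the good states starts at level 1, hence the constant [u Good + v] and one
   summand fewer. *)
have E N : stat_mean N.+1 (fun n s => u s + v * n%:R) =
    u Good * a + S (u Bad) N.+1 * b + S (u Good + v) N * g.
  rewrite /stat_mean; under eq_bigr do rewrite sum_bool.
  rewrite big_split /= [X in X + _]big_ord_recl /= mulr0 addr0 (mulrC a) addrAC.
  congr (_ + _ + _); rewrite /S mulr_suml; apply: eq_bigr => n _; first ring.
  by rewrite /bump /= add1n -natr1; ring.
rewrite -cvg_shiftS; under eq_fun do rewrite E.
have c w := @cvg_geom_affine _ _ hbeta w v.
apply: cvgD; [apply: cvgD|]; first exact: cvg_cst.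
  by apply: cvgMl; have := c (u Bad); rewrite -cvg_shiftS.
by apply: cvgMl; exact: c.
Qed.

Lemma stat_mass_cvg : stat_mean N (fun _ _ => 1) @[N --> \oo] --> (1 : R).
Proof.
have [_ _ r2] := matA_rows hA.
have := @stat_mean_affine (fun=> 1) 0.
have -> : (fun N => stat_mean N (fun n (s : bool) => 1 + 0 * n%:R)) =
    fun N => stat_mean N (fun _ _ => 1).
  apply/funext => N; congr stat_mean; apply/funext => n; apply/funext => s; ring.
rewrite (_ : _ + _ * g = 1)//.
by rewrite -[RHS]r2 !mul0r !addr0; ring.
Qed.

Lemma stat_mass_le1 N : mass stat N <= 1.
Proof.
have -> : mass stat N = stat_mean N (fun _ _ => 1).
  by apply: eq_bigr => n _; apply: eq_bigr => s _; rewrite mulr1.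
have c := stat_mass_cvg.
have nd : {homo (fun N => stat_mean N (fun _ _ => 1)) : n m / (n <= m)%N >-> n <= m}.
  apply/nondecreasing_seqP => n; rewrite /stat_mean big_ord_recr /= lerDl.
  by apply: sumr_ge0 => s _; rewrite mulr1 ltW.
have := nondecreasing_cvgn_le nd (cvgP _ c) N.
by rewrite (cvg_lim _ c).
Qed.

Lemma stat_le_geom : exists2 E, 0 <= E & forall n s, stat n s <= E * beta ^+ n.
Proof.
have [a0 b0 g0] := stat_pos hp hr hK hbeta hbeta_eq hA.
have gb : 0 < g / beta by rewrite divr_gt0.
exists (a + b + g / beta) => [|n s]; first by rewrite !addr_ge0 ?ltW.
have bn : 0 < beta ^+ n by rewrite exprn_gt0.
case: s n bn => [[|n] bn|n bn] /=.
- by rewrite mulr1; lra.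
- have -> : beta ^+ n * g = g / beta * beta ^+ n.+1.
    by rewrite exprS; field; rewrite gt_eqF.
  by rewrite ler_pM2r//; lra.
- by rewrite mulrC ler_pM2r//; lra.
Qed.

(** Invariance cancels the truncated mean of [arr_op f] against that of [f], up to boundary terms
    near the truncation level. These are quadratic in [N] times [beta ^+ N]. *)
Lemma stat_mean_drift (f : nat -> bool -> R) C :
  (forall n s, `|f n s| <= C * n.+1%:R ^+ 2) ->
  stat_mean N (drift f) @[N --> \oo] --> (0 : R).
Proof.
move=> fC; have [E E0 sE] := stat_le_geom.
have C0 : 0 <= C.
  by have := fC 0%N Good; rewrite expr1n mulr1; apply: le_trans.
pose inner N n s := \sum_(n' < N.+1) \sum_(s' : bool) kern n s n' s' * f n' s'.
have eqS N : stat_mean N (drift f) = \sum_(s : bool) stat N s * f N s -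
    \sum_(n < K.+1) \sum_(s : bool) stat (N + n)%N s * inner N (N + n)%N s.
  have e1 : stat_mean N.+1 f =
     \sum_(n < N + K.+1) \sum_(s : bool) stat n s * inner N n s.
    transitivity (\sum_(n' < N.+1) \sum_(s' : bool) \sum_(n < N + K.+1)
        \sum_(s : bool) stat n s * (kern n s n' s' * f n' s')).
      apply: eq_bigr => n' _; apply: eq_bigr => s' _.
      rewrite -(@statI n' s' (N + K.+1)); last by have := ltn_ord n'; lia.
      rewrite mulr_suml; apply: eq_bigr => n _; rewrite mulr_suml.
      by apply: eq_bigr => s _; rewrite mulrA.
    under eq_bigr do rewrite exchange_big.
    rewrite exchange_big /=; apply: eq_bigr => n _.
    under eq_bigr do rewrite exchange_big.
    rewrite exchange_big /=; apply: eq_bigr => s _.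
    rewrite mulr_sumr; apply: eq_bigr => n' _.
    by rewrite mulr_sumr.
  move: e1; rewrite {1}/stat_mean big_ord_recr big_split_ord /=.
  have -> : \sum_(n < N) \sum_(s : bool) stat n s * inner N n s = stat_mean N (arr_op f).
    apply: eq_bigr => n _; apply: eq_bigr => s _; congr (_ * _).
    by apply: kern_sum; have := ltn_ord n; lia.
  have -> : stat_mean N (drift f) = stat_mean N (arr_op f) - stat_mean N f.
    rewrite /stat_mean -sumrB; apply: eq_bigr => n _; rewrite -sumrB.
    by apply: eq_bigr => s _; rewrite /drift; ring.
  by rewrite -/(stat_mean N f) => e1; lra.
pose c := E * C * 2 * (1 + K.+1%:R).
have bnd N : `|stat_mean N (drift f)| <= c * (N.+1%:R ^+ 2 * beta ^+ N).
  have bN : 0 <= beta ^+ N by rewrite exprn_ge0// ltW.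
  have x0 : 0 <= C * N.+1%:R ^+ 2 by rewrite mulr_ge0// exprn_ge0.
  have st n s : stat (N + n)%N s <= E * beta ^+ N.
    apply: le_trans (sE _ _) _; rewrite ler_wpM2l// exprD ler_piMr//.
    by rewrite exprn_ile1// ltW.
  have inn n s : `|inner N n s| <= C * N.+1%:R ^+ 2.
    apply: le_trans (ler_norm_sum _ _ _) _.
    apply: (@le_trans _ _ (\sum_(n' < N.+1) \sum_(s' : bool) kern n s n' s' * (C * N.+1%:R ^+ 2))).
      apply: ler_sum => n' _; apply: le_trans (ler_norm_sum _ _ _) _.
      apply: ler_sum => s' _; rewrite normrM ger0_norm ?kern_ge0//.
      rewrite ler_wpM2l ?kern_ge0//; apply: le_trans (fC _ _) _.
      rewrite ler_wpM2l// lerXn2r ?nnegrE ?ler0n// ler_nat.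
      exact: ltn_ord.
    under eq_bigr do rewrite -mulr_suml.
    by rewrite -mulr_suml ler_piMl// kern_sum_le1.
  have term n s h : `|h| <= C * N.+1%:R ^+ 2 ->
      `|stat (N + n)%N s * h| <= E * C * (N.+1%:R ^+ 2 * beta ^+ N).
    move=> hh; rewrite normrM (gtr0_norm (stat0 _ _)).
    rewrite (_ : E * C * _ = E * beta ^+ N * (C * N.+1%:R ^+ 2)); last by ring.
    by rewrite ler_pM// ltW.
  set z := E * C * (N.+1%:R ^+ 2 * beta ^+ N) in term.
  rewrite eqS (le_trans (ler_normB _ _))//.
  rewrite (_ : c * _ = z * 2 + K.+1%:R * (z * 2)); last by rewrite /c /z; ring.
  apply: lerD.
    rewrite sum_bool (le_trans (ler_normD _ _))// mulr_natr mulr2n -(addn0 N).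
    by apply: lerD; apply: term; rewrite addn0.
  apply: le_trans (ler_norm_sum _ _ _) _.
  rewrite (_ : K.+1%:R * _ = \sum_(n < K.+1) (z * 2)); last first.
    by rewrite sumr_const card_ord mulr_natl.
  apply: ler_sum => n _; rewrite sum_bool (le_trans (ler_normD _ _))// mulr_natr mulr2n.
  by apply: lerD; apply: term.
apply/norm_cvg0P; apply: (squeeze_cvgr _ (cvg_cst 0)).
  by apply: nearW => N; rewrite normr_ge0; exact: bnd.
have -> : nbhs (0 : R) = nbhs (c * 0) by rewrite mulr0.
by apply: cvgMr; exact: cvg_poly2_geom.
Qed.

Lemma stat_mean_indic n s : stat_mean N (indic R n s) @[N --> \oo] --> stat n s.
Proof.
apply: cvg_near_cst; exists n.+1 => // N /= nN.
rewrite /stat_mean (bigD1 (Ordinal nN))//= (bigD1 s)//= /indic !eqxx mulr1.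
rewrite !big1 ?addr0// => [i iN|s' ss'].
  rewrite big1// => s' _; rewrite (_ : (_ == n) = false) ?mulr0//.
  by apply/negbTE; apply: contra iN => /eqP e; apply/eqP/val_inj.
by rewrite (negPf ss') mulr0.
Qed.

End StatLimits.

Section PotentialBounds.
Variables (R : realType) (p r : R).
Hypotheses (hp : 0 < p < 1) (hr : 0 < r < 1).

Let p0 : 0 < p. Proof. by case/andP: hp. Qed.
Let r0 : 0 < r. Proof. by case/andP: hr. Qed.

Let sq n : (1 : R) <= n.+1%:R ^+ 2.
Proof. by rewrite exprn_ege1// ler1n. Qed.

Let lin n : (n%:R : R) <= n.+1%:R ^+ 2.
Proof.
by rewrite (@le_trans _ _ n.+1%:R) ?ler_nat// expr2 ler_peMl// ler1n.
Qed.

Lemma indic_le n' s' n s : `|indic R n' s' n s| <= 1 * n.+1%:R ^+ 2.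
Proof. by rewrite mul1r ger0_norm// (le_trans _ (sq n))// lern1 leq_b1. Qed.

Lemma bad_ind_le n s : `|bad_ind R n s| <= 1 * n.+1%:R ^+ 2.
Proof. by rewrite mul1r ger0_norm// (le_trans _ (sq n))// lern1 leq_b1. Qed.

Lemma lin_pot_le n s : `|lin_pot p r n s| <= (1 + (p + r)^-1) * n.+1%:R ^+ 2.
Proof.
have c0 : 0 <= (p + r)^-1 by rewrite invr_ge0 addr_ge0// ltW.
rewrite (le_trans (ler_normB _ _))// mulrDl mul1r.
apply: lerD; first by rewrite ger0_norm//; exact: lin.
rewrite ger0_norm ?mulr_ge0// ler_wpM2l// (le_trans _ (sq n))//.
by rewrite lern1 leq_b1.
Qed.

Lemma quad_pot_le n s :
  `|quad_pot p r n s| <= (1 + (service_rate p r)^-1 + r^-1) * n.+1%:R ^+ 2.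
Proof.
have m0 : 0 <= (service_rate p r)^-1 by rewrite invr_ge0 divr_ge0 ?addr_ge0 ?ltW.
have i0 : 0 <= r^-1 by rewrite invr_ge0 ltW.
have c0 : 0 <= 1 + (service_rate p r)^-1 + r^-1 by rewrite !addr_ge0.
apply: le_trans (ler_norm_sum _ _ _) _.
apply: (@le_trans _ _ (\sum_(i < n) (1 + (service_rate p r)^-1 + r^-1) * n.+1%:R)).
  apply: ler_sum => i _; rewrite /sojourn ger0_norm; last first.
    by rewrite !addr_ge0// mulr_ge0.
  rewrite !mulrDl; apply: lerD; first (apply: lerD).
  - by rewrite mul1r ler1n.
  - by rewrite mulrC ler_wpM2l// ler_nat; have := ltn_ord i; lia.
  - by rewrite mulrC ler_wpM2l// ler_nat; case: (~~ s).
rewrite sumr_const card_ord -[X in X <= _]mulr_natr -mulrA ler_wpM2l// expr2 ler_wpM2l//.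
by rewrite ler_nat.
Qed.

End PotentialBounds.

(** * Finite-horizon expectations along channel paths *)

Section PathExpectation.
Context (d : measure_display) (T : measurableType d) (R : realType)
  (P : probability T R) (p r : R) (S : nat -> {RV P >-> bool}).
Hypothesis GE : is_GE_channel p r S.
Local Notation tr := (Defs.ge_trans p r).

Definition upd (h : nat -> bool) t b i := if i == t then b else h i.

Definition local (U : Type) t (F : (nat -> bool) -> U) :=
  forall h h', (forall i, (1 <= i <= t)%N -> h i = h' i) -> F h = F h'.

Lemma localW (U : Type) t u (F : (nat -> bool) -> U) :
  (t <= u)%N -> local t F -> local u F.
Proof.
by move=> tu F_loc h h' e; apply: F_loc => i /andP[i0 it]; rewrite e// i0 (leq_trans it).
Qed.

(** Prefixes are total functions, false outside the slots 1 to [t], so that functionals of infinite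
    paths can be evaluated on them directly. *)
Fixpoint paths t : seq (nat -> bool) :=
  if t is t'.+1 then [seq upd h t b | h <- paths t', b <- [:: true; false]]
  else [:: fun=> false].

Definition cyl t (h : nat -> bool) : set T :=
  [set w | forall i, (1 <= i <= t)%N -> S i w = h i].

Definition wt t h : R := fine (P (cyl t h)).

(* The expectation of F, provided that F only depends on slots 1, ..., t. *)
Definition Ex t (F : (nat -> bool) -> R) : R := \sum_(h <- paths t) wt t h * F h.

Lemma sum_pathsS (V : nmodType) t (G : (nat -> bool) -> V) :
  \sum_(h <- paths t.+1) G h = \sum_(h <- paths t) \sum_(b : bool) G (upd h t.+1 b).
Proof.
change (paths t.+1) with [seq upd h t.+1 b | h <- paths t, b <- [:: true; false]].
rewrite big_allpairs_dep; apply: eq_bigr => h _.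
by rewrite sum_bool !big_cons big_nil /= addr0.
Qed.

Lemma cyl0 h : cyl 0 h = setT.
Proof. by apply/seteqP; split => // w _ i; case: i. Qed.

Lemma cyl_upd t u h b : (t < u)%N -> cyl t (upd h u b) = cyl t h.
Proof.
move=> tu; apply/seteqP; split => w H i /andP[i1 it]; rewrite H ?i1//.
  by rewrite /upd ltn_eqF// (leq_ltn_trans it).
by rewrite /upd ltn_eqF// (leq_ltn_trans it).
Qed.

Lemma measurable_slot t b : measurable [set w | S t w = b].
Proof. by have := @measurable_funPTI _ _ _ _ (S t) [set b] Logic.I. Qed.

Lemma cylS t h b : cyl t.+1 (upd h t.+1 b) = cyl t h `&` [set w | S t.+1 w = b].
Proof.
apply/seteqP; split => [w H|w [H Sb] i /andP[i1]].
  split=> [i /andP[i1 it]|/=].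
    by rewrite H ?i1 ?leqW// /upd ltn_eqF.
  by rewrite H ?ltnSn//= /upd eqxx.
rewrite leq_eqVlt => /predU1P[->|it]; first by rewrite /upd eqxx.
by rewrite H ?i1// /upd ltn_eqF.
Qed.

Lemma measurable_cyl t h : measurable (cyl t h).
Proof.
elim: t h => [|t IH] h; first by rewrite cyl0.
have -> : cyl t.+1 h = cyl t.+1 (upd h t.+1 (h t.+1)).
  by congr cyl; apply/funext => i; rewrite /upd; case: eqP => // ->.
by rewrite cylS; apply: measurableI => //; exact: measurable_slot.
Qed.

Lemma prob_split (E : set T) t : measurable E ->
  P E = (\sum_(b : bool) P (E `&` [set w | S t w = b]))%E.
Proof.
move=> mE; rewrite big_bool /= -measureU; first congr (P _).
- rewrite -setIUr (_ : _ `|` _ = setT) ?setIT//; apply/seteqP; split => // w _ /=.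
  by case: (S t w); [left|right].
- by apply: measurableI => //; exact: measurable_slot.
- by apply: measurableI => //; exact: measurable_slot.
- by apply/seteqP; split => // w [] [_ /= ->] [].
Qed.

Lemma prob_paths (E : set T) t : measurable E ->
  P E = (\sum_(h <- paths t) P (E `&` cyl t h))%E.
Proof.
move=> mE; elim: t => [|t IH].
  by rewrite /= big_cons big_nil adde0 cyl0 setIT.
rewrite IH sum_pathsS; apply: eq_bigr => h _.
rewrite (@prob_split _ t.+1); last by apply: measurableI => //; exact: measurable_cyl.
by apply: eq_bigr => b _; rewrite cylS setIA.
Qed.

Lemma wt_ge0 t h : 0 <= wt t h.
Proof. by rewrite fine_ge0. Qed.

Lemma wtE t h : ((wt t h)%:E = P (cyl t h))%E.
Proof. by rewrite /wt fineK// fin_num_measure//; exact: measurable_cyl. Qed.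

Lemma measurable_local t (B : (nat -> bool) -> bool) : local t B ->
  measurable [set w | B (S^~ w)].
Proof.
elim: t B => [|t IH] B loc.
  case: (boolP (B (fun=> false))) => Bf.
    rewrite (_ : mkset _ = setT)//; apply/seteqP; split => // w _ /=.
    by rewrite (loc _ (fun=> false))//; case.
  rewrite (_ : mkset _ = set0)//; apply/seteqP; split => // w /=.
  by rewrite (loc _ (fun=> false)) ?(negPf Bf)//; case.
have locb b : local t (fun h => B (upd h t.+1 b)).
  move=> h h' e; apply: loc => i /andP[i1]; rewrite leq_eqVlt /upd => /predU1P[->|it].
    by rewrite eqxx.
  by rewrite ltn_eqF// e// i1.
have updS w : upd (S^~ w) t.+1 (S t.+1 w) = S^~ w.
  by apply/funext => i; rewrite /upd; case: eqP => // ->.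
have -> : [set w | B (S^~ w)] =
   ([set w | S t.+1 w = true] `&` [set w | B (upd (S^~ w) t.+1 true)]) `|`
   ([set w | S t.+1 w = false] `&` [set w | B (upd (S^~ w) t.+1 false)]).
  apply/seteqP; split => w /=.
    by rewrite -{1}updS; case: (S t.+1 w) => ?; [left|right].
  by case=> -[e]; rewrite -e updS.
by apply: measurableU; (apply: measurableI; [exact: measurable_slot|exact: IH (locb _)]).
Qed.

(** A local event is a finite disjoint union of cylinders; thus finite sums replace integrals. *)
Lemma prob_local t (B : (nat -> bool) -> bool) : local t B ->
  P [set w | B (S^~ w)] = ((Ex t (fun h => (B h)%:R))%:E)%E.
Proof.
move=> loc; rewrite (@prob_paths _ t); last exact: measurable_local loc.
rewrite /Ex -sumEFin; apply: eq_bigr => h _.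
have Bh w : cyl t h w -> B (S^~ w) = B h by move=> H; exact: loc.
rewrite EFinM wtE; case: (boolP (B h)) => Bht.
  rewrite mule1; congr (P _); apply/seteqP; split => [w []//|w H]; split => //=.
  by rewrite Bh.
rewrite mule0 (_ : _ `&` _ = set0) ?measure0//.
by apply/seteqP; split => // w [/= + H]; rewrite Bh// (negPf Bht).
Qed.

Lemma ExD t F G : Ex t (fun h => F h + G h) = Ex t F + Ex t G.
Proof. by rewrite /Ex -big_split; apply: eq_bigr => h _ /=; ring. Qed.

Lemma ExZ t c F : Ex t (fun h => c * F h) = c * Ex t F.
Proof. by rewrite /Ex mulr_sumr; apply: eq_bigr => h _ /=; ring. Qed.

Lemma Ex_sum t (I : Type) (l : seq I) (F : I -> (nat -> bool) -> R) :
  Ex t (fun h => \sum_(i <- l) F i h) = \sum_(i <- l) Ex t (F i).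
Proof.
by rewrite /Ex exchange_big; apply: eq_bigr => h _ /=; rewrite mulr_sumr.
Qed.

Lemma le_Ex t F G : (forall h, F h <= G h) -> Ex t F <= Ex t G.
Proof. by move=> FG; apply: ler_sum => h _; rewrite ler_wpM2l// wt_ge0. Qed.

Lemma Ex_ge0 t F : (forall h, 0 <= F h) -> 0 <= Ex t F.
Proof. by move=> F0; apply: sumr_ge0 => h _; rewrite mulr_ge0// wt_ge0. Qed.

Lemma wt_split t h : wt t h = \sum_(b : bool) wt t.+1 (upd h t.+1 b).
Proof.
apply: EFin_inj; rewrite wtE (@prob_split _ t.+1); last exact: measurable_cyl.
by rewrite -sumEFin; apply: eq_bigr => b _; rewrite wtE cylS.
Qed.

Lemma Ex_localS t F : local t F -> Ex t.+1 F = Ex t F.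
Proof.
move=> loc; rewrite /Ex sum_pathsS; apply: eq_bigr => h _.
rewrite wt_split mulr_suml; apply: eq_bigr => b _; congr (_ * _).
by apply: loc => i /andP[_ it]; rewrite /upd ltn_eqF.
Qed.

Lemma Ex_local t u F : (t <= u)%N -> local t F -> Ex u F = Ex t F.
Proof.
move=> /subnKC <- loc; elim: (u - t)%N => [|k IH]; first by rewrite addn0.
by rewrite addnS Ex_localS//; exact: localW (leq_addr _ _) loc.
Qed.

Lemma Ex_cst t c : Ex t (fun=> c) = c.
Proof.
rewrite (@Ex_local 0)//= /Ex /= big_cons big_nil addr0 /wt cyl0.
by rewrite probability_setT mul1r.
Qed.

Lemma wt_upd t h b : (0 < t)%N -> wt t.+1 (upd h t.+1 b) = wt t h * tr (h t) b.
Proof.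
move=> t0; have := GE (upd h t.+1 b) t0; rewrite -!/(cyl _ _) -!wtE -EFinM => -[->].
by rewrite /wt cyl_upd// /upd eqxx ltn_eqF.
Qed.

(** The Markov property in one-step form; slot 0 lies outside the channel law, hence [0 < t]. *)
Lemma Ex_step t F : (0 < t)%N ->
  Ex t.+1 F = Ex t (fun h => \sum_(b : bool) tr (h t) b * F (upd h t.+1 b)).
Proof.
move=> t0; rewrite /Ex sum_pathsS; apply: eq_bigr => h _.
by rewrite mulr_sumr; apply: eq_bigr => b _; rewrite wt_upd// mulrA.
Qed.

Lemma chebyshev_path t (Y : (nat -> bool) -> R) eps : 0 < eps -> local t Y ->
  (P [set w | (eps <= `|Y (S^~ w)|)%R] <= (Ex t (fun h => Y h ^+ 2) / eps ^+ 2)%:E)%E.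
Proof.
move=> e0 loc.
rewrite (@prob_local t (fun h => eps <= `|Y h|)); last first.
  by move=> h h' e; rewrite (loc _ _ e).
have e2 : 0 < eps ^+ 2 by rewrite exprn_gt0.
rewrite lee_fin ler_pdivlMr// mulrC -ExZ; apply: le_Ex => h.
case: (leP eps `|Y h|) => [le|_] /=; last by rewrite mulr0 sqr_ge0.
rewrite mulr1 -[X in _ <= X]real_normK ?num_real//.
by rewrite lerXn2r ?nnegrE// ltW.
Qed.

(** For each threshold the Chebyshev bounds are summable, so by Borel-Cantelli it is exceeded
    finitely often almost surely; countably many thresholds suffice for the limit. *)
Lemma ae_cvg0_of_second_moment (Y : nat -> (nat -> bool) -> R) (N : nat -> nat) C :
  (forall k, local (N k) (Y k)) ->
  (forall k, Ex (N k) (fun h => Y k h ^+ 2) <= C / k.+1%:R ^+ 2) ->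
  {ae P, forall w, Y k (S^~ w) @[k --> \oo] --> (0 : R)}.
Proof.
move=> loc EY.
have C0 : 0 <= C.
  have := EY 0%N; rewrite expr1n divr1; apply: le_trans.
  by apply: Ex_ge0 => h; exact: sqr_ge0.
pose e j : R := j.+1%:R^-1.
have e0 j : 0 < e j by rewrite invr_gt0.
pose F j k := [set w | e j <= `|Y k (S^~ w)|].
have mF j k : measurable (F j k).
  apply: (@measurable_local (N k) (fun h => e j <= `|Y k h|)) => h h' eh.
  by rewrite (loc _ _ _ eh).
have F0 j : P (lim_sup_set (F j)) = 0%E.
  apply: lim_sup_set_cvg0; first exact: mF.
  pose D := C / e j ^+ 2.
  have D0 : 0 <= D by rewrite divr_ge0// exprn_ge0// ltW.
  apply: (@le_lt_trans _ _ (2 * D)%:E); last exact: ltry.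
  apply: lime_le; first by apply: is_cvg_nneseries => k _ _; exact: measure_ge0.
  apply: nearW => n.
  (* Telescoping majorant: the inverse square of [k.+1] is at most twice
     [k.+1%:R^-1 - k.+2%:R^-1]. *)
  apply: (@le_trans _ _ (\sum_(0 <= k < n) (2 * D * (k.+1%:R^-1 - k.+2%:R^-1))%:E)%E).
    apply: lee_sum => k _; apply: le_trans (chebyshev_path (e0 j) (loc k)) _.
    rewrite lee_fin; apply: (@le_trans _ _ (D / k.+1%:R ^+ 2)).
      rewrite /D mulrAC; apply: ler_wpM2r; last exact: EY.
      by rewrite invr_ge0 exprn_ge0// ltW.
    rewrite (mulrC 2) -[leRHS]mulrA; apply: ler_wpM2l => //.
    have k1 : 0 < k.+1%:R :> R by [].
    have -> : k.+2%:R = k.+1%:R + 1 :> R by rewrite natr1.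
    have k2 : 1 <= k.+1%:R :> R by rewrite ler1n.
    rewrite -subr_ge0.
    have -> : 2 * (k.+1%:R^-1 - (k.+1%:R + 1)^-1) - k.+1%:R ^- 2 =
      (k.+1%:R - 1) / (k.+1%:R ^+ 2 * (k.+1%:R + 1)) :> R.
      by field; rewrite !gt_eqF// addr_gt0.
    by rewrite divr_ge0 ?subr_ge0// mulr_ge0 ?exprn_ge0 ?addr_ge0.
  rewrite sumEFin lee_fin -mulr_sumr; apply: ler_piMr; first by rewrite mulr_ge0.
  have -> : \sum_(0 <= k < n) (k.+1%:R^-1 - k.+2%:R^-1) = 1 - n.+1%:R^-1 :> R.
    elim: n => [|n IH]; first by rewrite big_geq// invr1 subrr.
    by rewrite big_nat_recr//= IH addrA subrK.
  by rewrite gerBl invr_ge0.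
have ae j : {ae P, forall w, ~ lim_sup_set (F j) w}.
  exists (lim_sup_set (F j)); split; [|exact: F0|by move=> w /= /contrapT].
  by apply: bigcapT_measurable => n; apply: bigcup_measurable => k _; exact: mF.
apply: filterS (ae_foralln ae) => w H.
apply/cvgrPdist_lt => eps eps0.
have [j je] : exists j, e j < eps.
  exists (Num.trunc eps^-1); rewrite /e invf_plt ?posrE//.
  by rewrite truncnS_gt.
have : exists n, forall k, (n <= k)%N -> ~ F j k w.
  apply: contrapT => nex; apply: (H j) => n _.
  apply: contrapT => nF; apply: nex; exists n => k nk Fk; apply: nF.
  by exists k.
case=> n nF; exists n => // k /= nk.
rewrite sub0r normrN; apply: lt_trans je.
by rewrite ltNge; apply/negP => /(nF _ nk).
Qed.

End PathExpectation.

(** * Moments of the queue *)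

Section Queue.
Variable (K : nat).

(* Queue length at the end of slot t; the arrival of slot t + 1 occurs when
   K divides t. *)
Fixpoint qlen (s : nat -> bool) (t : nat) : nat :=
  if t is t'.+1 then qlen s t' + (K %| t')%N - s t'.+1 else 0.

Lemma qlen_local t : local t (qlen^~ t).
Proof.
elim: t => [//|t IH] h h' e /=.
rewrite e ?leqnn// (IH h h')// => i /andP[i1 it]; rewrite e// i1 ltnW//.
Qed.

Lemma qlen_le s t : (qlen s t <= t)%N.
Proof. by elim: t => //= t IH; case: (s _) (K %| t)%N => -[] /=; lia. Qed.

Lemma qlen_upd s t u b : (t < u)%N -> qlen (upd s u b) t = qlen s t.
Proof.
by move=> tu; apply: qlen_local => i /andP[_ it]; rewrite /upd ltn_eqF// (leq_ltn_trans it).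
Qed.

Lemma qlen_period s i k : (0 < K)%N -> (k <= K)%N ->
  (qlen s (i * K + k) <= (qlen s (i * K)).+1)%N.
Proof.
move=> K0; elim: k => [|k IH] kK; first by rewrite addn0.
rewrite addnS /=; case: k IH kK => [|k] IH kK.
  by rewrite addn0; case: (s _) (K %| _)%N => -[] /=; lia.
have -> : (K %| i * K + k.+1)%N = false.
  by rewrite dvdn_addr ?dvdn_mull// gtnNdvd.
by have := IH (ltnW kK); lia.
Qed.

End Queue.

(** * Moment bounds and martingale increments *)

Section ChainMoments.
Context (d : measure_display) (T : measurableType d) (R : realType)
  (P : probability T R) (p r : R) (S : nat -> {RV P >-> bool}).
Hypothesis GE : is_GE_channel p r S.
Variable K : nat.
Hypotheses (hp : 0 < p < 1) (hr : 0 < r < 1) (hK : (2 <= K)%N).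
Local Notation tr := (Defs.ge_trans p r).
Local Notation Ex := (Ex S).
Local Notation qlen := (qlen K).
Local Notation serve_op := (serve_op p r).
Local Notation arr_op := (arr_op p r K).

Definition at_slot (f : nat -> bool -> R) t s : R := f (qlen s t) (s t.+1).

Lemma at_slot_local f t : local t.+1 (at_slot f t).
Proof.
move=> h h' e; rewrite /at_slot e ?leqnn// (@qlen_local _ _ h h')// => i /andP[i1 it].
by rewrite e// i1 ltnW.
Qed.

(** The index counts completed slots: the arrival of slot [t + 1] joins first and may be served in
    that same slot. *)
Definition slot_op (f : nat -> bool -> R) t n s := serve_op f (n + (K %| t)%N) s.

Lemma at_slot_upd f t s b : at_slot f t.+1 (upd s t.+2 b) =
  f (qlen s t + (K %| t)%N - s t.+1)%N b.
Proof. by rewrite /at_slot qlen_upd//= /upd eqxx. Qed.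

Lemma Ex_at_slotS f t : Ex t.+2 (at_slot f t.+1) = Ex t.+1 (at_slot (slot_op f t) t).
Proof.
rewrite (Ex_step GE)//; congr (Ex _ _); apply/funext => h.
by apply: eq_bigr => b _; rewrite at_slot_upd.
Qed.

(** Only the first slot of a period has an arrival; the remaining ones apply [serve_op] alone. *)
Lemma Ex_at_period f i :
  Ex (i.+1 * K).+1 (at_slot f (i.+1 * K)) = Ex (i * K).+1 (at_slot (arr_op f) (i * K)).
Proof.
have claim k : forall f, (k < K)%N -> Ex (i * K + k.+1).+1 (at_slot f (i * K + k.+1)) =
    Ex (i * K).+1 (at_slot (fun n s => iter k.+1 serve_op f n.+1 s) (i * K)).
  elim: k => [|k IH] f' kK.
    rewrite addn1 Ex_at_slotS; congr (Ex _ (at_slot _ _)).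
    by apply/funext => n; apply/funext => s; rewrite /slot_op dvdn_mull// addn1.
  rewrite addnS Ex_at_slotS.
  have -> : slot_op f' (i * K + k.+1) = serve_op f'.
    apply/funext => n; apply/funext => s.
    by rewrite /slot_op dvdn_addr ?dvdn_mull// gtnNdvd// addn0.
  rewrite IH; last exact: ltnW.
  congr (Ex _ (at_slot _ _)).
  by apply/funext => n; apply/funext => s; rewrite -iterSr.
case: K hK claim => // K' _ claim; rewrite mulSnr claim//.
congr (Ex _ (at_slot _ _)).
by apply/funext => n; apply/funext => s; rewrite -arr_op_serve.
Qed.

Lemma kern_expand n s n' s' : kern p r K n s n' s' =
  \sum_(n1 < n' + K) \sum_(s1 : bool) kern p r K n1 s1 n' s' * indic R n1 s1 n s.
Proof.
case: (ltnP n (n' + K)) => nN; last first.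
  rewrite kern0// big1// => i _; rewrite big1// => s1 _.
  rewrite /indic (_ : (n == i) = false) ?mulr0//; apply/eqP.
  by have := ltn_ord i; lia.
rewrite (bigD1 (Ordinal nN))//= (bigD1 s)//= /indic !eqxx mulr1.
rewrite !big1 ?addr0// => [i iN|s1 ss1].
  rewrite big1// => s1 _; rewrite (_ : (n == i) = false) ?mulr0//.
  by apply/negbTE; apply: contra iN => /eqP e; apply/eqP/val_inj.
by rewrite (eq_sym s) (negPf ss1) andbF mulr0.
Qed.

Lemma serve_op_le C (f : nat -> bool -> R) : (forall n s, `|f n s| <= C * n.+1%:R ^+ 2) ->
  forall n s, `|serve_op f n s| <= C * n.+1%:R ^+ 2.
Proof.
move=> f_le n s.
have C0 : 0 <= C by have := f_le 0 Good; rewrite expr1n mulr1; apply: le_trans.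
have b s1 : `|tr s s1 * f (n - s)%N s1| <= tr s s1 * (C * n.+1%:R ^+ 2).
  have t0 : 0 <= tr s s1.
    by case/andP: hp => ? ?; case/andP: hr => ? ?; case: s s1 => -[] /=; rewrite ?subr_ge0 ltW.
  rewrite normrM ger0_norm//; apply: ler_wpM2l => //.
  apply: le_trans (f_le _ _) _; apply: ler_wpM2l => //.
  by rewrite lerXn2r ?nnegrE// ler_nat; lia.
apply: le_trans (ler_norm_sum _ _ _) _; apply: le_trans (ler_sum _ (fun s1 _ => b s1)) _.
by rewrite -mulr_suml tr_sum1 mul1r.
Qed.

Variables (pi : nat -> bool -> R) (beta E : R).
Hypotheses (pi0 : forall n s, 0 < pi n s) (piI : invariant p r K pi).
Hypotheses (hbeta : 0 < beta < 1) (pi_le : forall n s, pi n s <= E * beta ^+ n).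

(* The queue starts empty, and the point masses at (0, s) are bounded by
   multiples of the stationary law, a bound which the dynamics preserve. *)
Lemma dominated : exists2 D, 0 <= D & forall i n s,
  Ex (i * K).+1 (at_slot (indic R n s) (i * K)) <= D * pi n s.
Proof.
pose D := (pi 0%N Good)^-1 + (pi 0%N Bad)^-1.
have D0 : 0 <= D by rewrite addr_ge0// invr_ge0 ltW.
exists D => // i; elim: i => [|i IH] n s.
  rewrite mul0n; case: n => [|n].
    apply: (@le_trans _ _ 1).
      rewrite -[X in _ <= X](Ex_cst S 1 1); apply: le_Ex => h.
      by rewrite /at_slot /indic lern1 leq_b1.
    rewrite /D mulrDl; case: s.
      by rewrite mulVf ?gt_eqF// lerDl mulr_ge0 ?invr_ge0 ?ltW.
    by rewrite [X in _ + X]mulVf ?gt_eqF// lerDr mulr_ge0 ?invr_ge0 ?ltW.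
  have -> : at_slot (indic R n.+1 s) 0 = fun=> 0 by apply/funext => h.
  by rewrite Ex_cst mulr_ge0// ltW.
rewrite Ex_at_period.
have -> : at_slot (arr_op (indic R n s)) (i * K) = fun h =>
    \sum_(n1 < n + K) \sum_(s1 : bool) kern p r K n1 s1 n s * at_slot (indic R n1 s1) (i * K) h.
  by apply/funext => h; rewrite /at_slot arr_op_indic kern_expand.
rewrite Ex_sum -(@piI n s _ (leqnn _)) mulr_sumr; apply: ler_sum => n1 _.
rewrite Ex_sum mulr_sumr; apply: ler_sum => s1 _.
rewrite ExZ mulrA mulrC; apply: ler_wpM2r; first exact: kern_ge0.
exact: IH.
Qed.

(** Domination by the invariant law gives geometric tails, uniformly over the period starts. Order
    four is what squares of quadratic potentials require. *)
Lemma moment4 : exists2 B, 0 <= B &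
  forall t, Ex t.+1 (at_slot (fun n _ => n.+1%:R ^+ 4) t) <= B.
Proof.
have [D D0 dom] := dominated; have [C [gamma [C0 /andP[g0 g1] le4]]] := poly4_geom_le hbeta.
have E0 : 0 <= E by have := le_trans (ltW (pi0 0%N Good)) (pi_le 0%N Good); rewrite mulr1.
have K0 : (0 < K)%N by exact: ltnW.
pose B := D * (E * C * 2) / (1 - gamma).
have g10 : 0 < 1 - gamma by rewrite subr_gt0.
have B0 : 0 <= B by rewrite /B divr_ge0 ?mulr_ge0// ltW.
have periods i : Ex (i * K).+1 (at_slot (fun n _ => n.+1%:R ^+ 4) (i * K)) <= B.
  set t := (i * K)%N.
  have -> : at_slot (fun n _ => n.+1%:R ^+ 4) t = fun h =>
      \sum_(n < t.+1) \sum_(s : bool) n.+1%:R ^+ 4 * at_slot (indic R n s) t h.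
    apply/funext => h; rewrite /at_slot.
    have qt : (qlen h t < t.+1)%N by rewrite ltnS qlen_le.
    rewrite (bigD1 (Ordinal qt))//= (bigD1 (h t.+1))//= /indic !eqxx mulr1.
    rewrite !big1 ?addr0// => [j jN|s1 ss1].
      rewrite big1// => s1 _; rewrite (_ : (_ == _) = false) ?mulr0//.
      by apply/negbTE; apply: contra jN => /eqP e; apply/eqP/val_inj.
    by rewrite (eq_sym (h _)) (negPf ss1) andbF mulr0.
  rewrite Ex_sum; apply: (@le_trans _ _ (\sum_(n < t.+1) D * (E * C * 2) * gamma ^+ n)).
    apply: ler_sum => n _; rewrite Ex_sum sum_bool !ExZ.
    rewrite (_ : D * _ * _ = D * (E * (C * gamma ^+ n)) + D * (E * (C * gamma ^+ n))); last by ring.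
    have b s : n.+1%:R ^+ 4 * Ex t.+1 (at_slot (indic R n s) t) <= D * (E * (C * gamma ^+ n)).
      apply: (@le_trans _ _ (n.+1%:R ^+ 4 * (D * (E * beta ^+ n)))).
        apply: ler_wpM2l; first exact: exprn_ge0.
        by apply: le_trans (dom _ _ _) _; rewrite ler_wpM2l.
      rewrite (_ : _ * _ = D * (E * (n.+1%:R ^+ 4 * beta ^+ n))); last by ring.
      by rewrite !ler_wpM2l.
    by rewrite lerD.
  rewrite -mulr_sumr /B ler_wpM2l ?mulr_ge0// -(ler_pM2l g10) mulfV ?gt_eqF//.
  have := @geom_sum R gamma t.+1; rewrite big_mkord => ->.
  by rewrite gerBl exprn_ge0// ltW.
(* Within a period the queue exceeds its length at the start by at most one, so [n.+1] at most
   doubles; 16 is [2 ^+ 4]. *)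
exists (16 * B) => [|t]; first by rewrite mulr_ge0.
have tE := divn_eq t K; set i := (t %/ K)%N in tE.
have loc := @at_slot_local (fun n _ => n.+1%:R ^+ 4) (i * K)%N.
apply: (@le_trans _ _ (Ex t.+1 (fun h => 16 * at_slot (fun n _ => n.+1%:R ^+ 4) (i * K) h))).
  apply: le_Ex => h; rewrite /at_slot {1}tE.
  rewrite (_ : 16 = 2 ^+ 4); last by ring.
  rewrite -exprMn lerXn2r ?nnegrE// -natrM ler_nat.
  apply: (@leq_trans (qlen h (i * K)).+2).
    by rewrite ltnS; exact: qlen_period (ltnW (ltn_pmod _ K0)).
  by rewrite mul2n -addnn addSn addnS !ltnS leq_addr.
rewrite ExZ (@Ex_local _ _ _ _ _ (i * K).+1)//; first by rewrite ler_wpM2l.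
by rewrite ltnS leq_divM.
Qed.

Variables (g : nat -> nat -> bool -> R) (C : R).
Hypothesis g_le : forall t n s, `|g t n s| <= C * n.+1%:R ^+ 2.

Let C0 : 0 <= C.
Proof. by have := g_le 0 0 Good; rewrite expr1n mulr1; apply: le_trans. Qed.

(** The potential [g] may vary with the slot, which [interpolate] uses to concentrate the drift on
    arrivals. *)
Definition slot_drift t n s := slot_op (g t.+1) t n s - g t n s.

Let Y t h := at_slot (g t.+1) t.+1 h - at_slot (slot_op (g t.+1) t) t h.
Let W M h := \sum_(t < M) Y t h.

Let Y_local t : local t.+2 (Y t).
Proof.
move=> h h' e; rewrite /Y (@at_slot_local _ _ h h')//.
by rewrite (@at_slot_local _ t h h')// => i /andP[i1 it]; rewrite e// i1 leqW.
Qed.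

Let W_local M : local M.+1 (W M).
Proof.
move=> h h' e; apply: eq_bigr => t _; apply: Y_local => i /andP[i1 it].
by rewrite e// i1 (leq_trans it)// ltnS.
Qed.

(** Given the first [t + 1] slots, the only new randomness in [Y t] is the state of slot [t + 2],
    and [slot_op] is the conditional mean. *)
Lemma martingale_orthogonal t F : local t.+1 F -> Ex t.+2 (fun h => F h * Y t h) = 0.
Proof.
move=> loc; rewrite (Ex_step GE)// -[RHS](Ex_cst S t.+1 0); congr (Ex _ _).
apply/funext => h.
have FE b : F (upd h t.+2 b) = F h.
  by apply: loc => i /andP[_ it]; rewrite /upd ltn_eqF.
have opE b : at_slot (slot_op (g t.+1) t) t (upd h t.+2 b) = at_slot (slot_op (g t.+1) t) t h.
  by apply: at_slot_local => i /andP[_ it]; rewrite /upd ltn_eqF.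
rewrite sum_bool /Y !FE !opE !at_slot_upd.
have := tr_sum1 p r (h t.+1); rewrite sum_bool => t1.
have : at_slot (slot_op (g t.+1) t) t h =
   tr (h t.+1) true * g t.+1 (qlen h t + (K %| t)%N - h t.+1)%N true +
   tr (h t.+1) false * g t.+1 (qlen h t + (K %| t)%N - h t.+1)%N false.
  exact: sum_bool.
set A := at_slot _ _ _; set a := tr _ true in t1 *; set b := tr _ false in t1 *.
set x := g _ _ true; set y := g _ _ false => AE.
rewrite AE.
have -> : a * (F h * (x - (a * x + b * y))) + b * (F h * (y - (a * x + b * y))) =
  F h * ((1 - (a + b)) * (a * x + b * y)) by ring.
by rewrite t1 subrr mul0r mulr0.
Qed.

(** The summed drift is a boundary term minus the martingale [W], whose increments are orthogonal
    and bounded in mean square. *)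
Lemma drift_second_moment : exists2 B, 0 <= B & forall M,
  Ex M.+1 (fun h => (\sum_(t < M) at_slot (slot_drift t) t h) ^+ 2) <= B * M.+1%:R.
Proof.
have [B B0 m4] := moment4.
(* An arrival at most doubles [n.+1], whence the factor 4. *)
have op_le t n s : `|slot_op (g t.+1) t n s| <= 4 * C * n.+1%:R ^+ 2.
  apply: le_trans (serve_op_le (g_le t.+1) _ _) _.
  rewrite (_ : 4 * C * _ = C * (2 * n.+1%:R) ^+ 2); last by ring.
  rewrite ler_wpM2l// lerXn2r ?nnegrE ?mulr_ge0// -natrM ler_nat.
  by case: (K %| t)%N => /=; lia.
have sq (x c : R) n : `|x| <= c * n.+1%:R ^+ 2 -> x ^+ 2 <= c ^+ 2 * n.+1%:R ^+ 4.
  move=> xc; rewrite -[leLHS]real_normK ?num_real//.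
  rewrite (_ : c ^+ 2 * _ = (c * n.+1%:R ^+ 2) ^+ 2); last by ring.
  by rewrite lerXn2r ?nnegrE// (le_trans _ xc).
have at_sq f c t : 0 <= c -> (forall n s, `|f n s| <= c * n.+1%:R ^+ 2) ->
    Ex t.+1 (fun h => at_slot f t h ^+ 2) <= c ^+ 2 * B.
  move=> c0 fc; apply: (@le_trans _ _
    (Ex t.+1 (fun h => c ^+ 2 * at_slot (fun n _ => n.+1%:R ^+ 4) t h))).
    by apply: le_Ex => h; exact: sq (fc _ _).
  by rewrite ExZ ler_wpM2l// sqr_ge0.
(* 34 is 2 + 2 * 16, from bounding the square of a difference by twice the sum of squares. *)
have EY t : Ex t.+2 (fun h => Y t h ^+ 2) <= 34 * C ^+ 2 * B.
  apply: (@le_trans _ _ (Ex t.+2 (fun h => 2 * (at_slot (g t.+1) t.+1 h ^+ 2) +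
      2 * (at_slot (slot_op (g t.+1) t) t h ^+ 2)))).
    apply: le_Ex => h; rewrite /Y; set x := at_slot _ _ _; set y := at_slot _ _ _.
    rewrite -subr_ge0 (_ : _ - _ = (x + y) ^+ 2); first exact: sqr_ge0.
    by ring.
  rewrite ExD !ExZ.
  have e1 := at_sq _ _ t.+1 C0 (g_le t.+1).
  have e2 : Ex t.+2 (fun h => at_slot (slot_op (g t.+1) t) t h ^+ 2) <= (4 * C) ^+ 2 * B.
    rewrite Ex_localS; first by apply: at_sq (op_le t); rewrite mulr_ge0.
    by move=> h h' e; rewrite (at_slot_local _ e).
  by rewrite (_ : 34 * _ * _ = 2 * (C ^+ 2 * B) + 2 * ((4 * C) ^+ 2 * B)); [lra|ring].
have EW M : Ex M.+1 (fun h => W M h ^+ 2) <= M%:R * (34 * C ^+ 2 * B).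
  elim: M => [|M IH].
    rewrite mul0r (_ : (fun h => _) = fun=> 0) ?Ex_cst//.
    by apply/funext => h; rewrite /W big_ord0 expr0n.
  have -> : (fun h => W M.+1 h ^+ 2) = fun h => W M h ^+ 2 + (2 * (W M h * Y M h) + Y M h ^+ 2).
    by apply/funext => h; rewrite /W big_ord_recr /=; ring.
  rewrite ExD ExD ExZ martingale_orthogonal// mulr0 add0r -natr1 mulrDl mul1r lerD//.
  rewrite Ex_localS//; move=> h h' e; by rewrite (W_local e).
(* The 3 comes from the square of a sum of three terms; 36 is 34 plus the two boundary terms. *)
exists (3 * (36 * C ^+ 2 * B)) => [|M]; first by rewrite !mulr_ge0// sqr_ge0.
have RE h : \sum_(t < M) at_slot (slot_drift t) t h =
    at_slot (g M) M h - at_slot (g 0) 0 h - W M h.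
  elim: M => [|M IH]; first by rewrite /W !big_ord0; ring.
  by rewrite /W !big_ord_recr /= IH /W /Y /at_slot /slot_drift; ring.
apply: (@le_trans _ _ (Ex M.+1 (fun h => 3 * (at_slot (g M) M h ^+ 2) +
   (3 * (at_slot (g 0) 0 h ^+ 2) + 3 * (W M h ^+ 2))))).
  apply: le_Ex => h; rewrite RE.
  set x := at_slot _ _ _; set y := at_slot _ _ _; set z := W _ _.
  rewrite -subr_ge0 (_ : _ - _ = (x + y) ^+ 2 + (x + z) ^+ 2 + (y - z) ^+ 2); last by ring.
  by rewrite !addr_ge0// sqr_ge0.
rewrite !ExD !ExZ.
have e1 := at_sq _ _ M C0 (g_le M).
have e2 : Ex M.+1 (fun h => at_slot (g 0) 0 h ^+ 2) <= C ^+ 2 * B.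
  rewrite (@Ex_local _ _ _ _ _ 1)//; first exact: at_sq.
  by move=> h h' e; rewrite (at_slot_local _ e).
have e3 := EW M.
have z0 : 0 <= C ^+ 2 * B by rewrite mulr_ge0// sqr_ge0.
set z := C ^+ 2 * B in e1 e2 z0.
rewrite (_ : 3 * (36 * C ^+ 2 * B) * M.+1%:R =
    3 * (M%:R * (34 * C ^+ 2 * B)) + 6 * (M%:R * z) + 108 * z); last first.
  by rewrite /z -[M.+1%:R]natr1; ring.
have : 0 <= M%:R * z by rewrite mulr_ge0.
lra.
Qed.

(** Over K times [k.+1 ^ 2] slots the second moment is of order [k.+1 ^ 2]; normalised by the fourth
    power it is summable, which is the reason for averaging along squares. *)
Lemma ae_slot_drift : {ae P, forall w,
  (k.+1 ^ 2)%:R^-1 * (\sum_(t < k.+1 ^ 2 * K) at_slot (slot_drift t) t (S^~ w))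
    @[k --> \oo] --> (0 : R)}.
Proof.
have [B B0 m2] := drift_second_moment.
apply: (@ae_cvg0_of_second_moment _ _ _ _ S
  (fun k h => (k.+1 ^ 2)%:R^-1 * (\sum_(t < k.+1 ^ 2 * K) at_slot (slot_drift t) t h))
  (fun k => (k.+1 ^ 2 * K).+1) (B * K.+1%:R)) => k.
  move=> h h' e; congr (_ * _); apply: eq_bigr => t _; apply: at_slot_local => i /andP[i1 it].
  by rewrite e// i1 (leq_trans it)// ltnS ltnW.
have -> : (fun h => ((k.+1 ^ 2)%:R^-1 *
    (\sum_(t < k.+1 ^ 2 * K) at_slot (slot_drift t) t h)) ^+ 2) =
   fun h => k.+1%:R ^- 4 * (\sum_(t < k.+1 ^ 2 * K) at_slot (slot_drift t) t h) ^+ 2.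
  by apply/funext => h; rewrite exprMn natrX -exprVn -exprM -exprVn.
rewrite ExZ; have k0 : 0 < k.+1%:R :> R by [].
apply: (@le_trans _ _ (k.+1%:R ^- 4 * (B * (K.+1%:R * k.+1%:R ^+ 2)))).
  rewrite ler_wpM2l ?invr_ge0 ?exprn_ge0//; apply: le_trans (m2 _) _.
  rewrite ler_wpM2l// -natrX -natrM ler_nat.
  by have : (0 < k.+1 ^ 2)%N by []; nia.
rewrite le_eqVlt; apply/orP; left; apply/eqP; field.
by rewrite gt_eqF.
Qed.

End ChainMoments.

(** * Empirical frequencies *)

Section UltraLimits.
Variable (R : realType).

(** If convergence fails, the indices sent outside some neighbourhood of [l] meet every tail, and an
    ultrafilter through them contradicts the hypothesis. *)
Lemma cvg_ultra (u : nat -> R) (l : R) :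
  (forall U : set_system nat, UltraFilter U -> \oo `<=` U -> u n @[n --> U] --> l) ->
  u n @[n --> \oo] --> l.
Proof.
move=> H A Al; apply: contrapT => nA.
pose B := u @^-1` A.
have WP : ProperFilter (within (~` B) \oo).
  split; last exact: within_filter.
  move=> W; apply: nA; rewrite -/(\oo B).
  by apply: (@filterS _ \oo _ _ _ _ W) => n nB; apply: contrapT => /nB.
have [U [UU WU]] := ultraFilterLemma WP.
have oU : \oo `<=` U.
  by move=> V oV; apply: WU; apply: (@filterS _ \oo _ _ _ _ oV) => n Vn _.
have UB : U B by exact: H.
have UnB : U (~` B) by apply: WU; exact: withinT.
have [nU FU] := @ultra_proper _ U UU.
by apply: nU; rewrite -(setICr B); exact: (@filterI _ U FU).
Qed.

Lemma ultra_bounded_cvg (U : set_system nat) (u : nat -> R) :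
  UltraFilter U -> (forall n, 0 <= u n <= 1) -> cvg (u n @[n --> U]).
Proof.
move=> UU u01.
have cpt := @segment_compact R 0 1.
have PU : ProperFilter (u n @[n --> U]) by exact: fmap_proper_filter.
have := cpt (u n @[n --> U]) PU.
case; first by apply: nearW => n; rewrite /= in_itv /=; exact: u01.
move=> x [_ clx]; apply/cvg_ex; exists x => A Ax.
case: (in_ultra_setVsetC (u @^-1` A) UU) => // UnA.
by have [y [/= nAy Ay]] := clx (~` A) A UnA Ax.
Qed.

End UltraLimits.

Section Frequencies.
Variables (R : realType) (p r : R) (K : nat).
Hypotheses (hp : 0 < p < 1) (hr : 0 < r < 1) (hK : (2 <= K)%N).
Hypothesis hstab : K%:R^-1 < r / (p + r).
Local Notation drift := (drift p r K).
Local Notation kern := (kern p r K).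
Local Notation mu := (service_rate p r).

Definition period_avg (h : nat -> bool) k (f : nat -> bool -> R) : R :=
  (k.+1 ^ 2)%:R^-1 * \sum_(i < k.+1 ^ 2) at_slot K f (i * K) h.

Lemma period_avg_lin h k c f f' :
  period_avg h k (fun n s => c * f n s + f' n s) = c * period_avg h k f + period_avg h k f'.
Proof.
rewrite /period_avg (mulrCA c) -mulrDr; congr (_ * _).
by rewrite mulr_sumr -big_split; apply: eq_bigr.
Qed.

Lemma period_avg1 h k : period_avg h k (fun _ _ => 1) = 1.
Proof.
rewrite /period_avg /at_slot sumr_const card_ord mulVf// pnatr_eq0 expn_eq0.
Qed.

Lemma period_avg_le h k f f' : (forall n s, f n s <= f' n s) ->
  period_avg h k f <= period_avg h k f'.
Proof.
move=> ff; apply: ler_wpM2l; first by rewrite invr_ge0.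
by apply: ler_sum => i _; exact: ff.
Qed.

Variable (pi : nat -> bool -> R).
Hypotheses (pi0 : forall n s, 0 < pi n s) (piI : invariant p r K pi).
Hypothesis pi1 : forall N, mass pi N <= 1.

(* Expected number of idle good slots in a period, in terms of the state at
   its beginning. *)
Definition idle n s := drift (lin_pot p r) n s + (K%:R * mu - 1).

Lemma idle0 n s : (K <= n)%N -> idle n s = 0.
Proof.
move=> Kn; rewrite /idle /drift arr_op_lin//; last exact: leqW.
by ring.
Qed.

Hypothesis pi_idle : \sum_(n < K) \sum_(s : bool) pi n s * idle n s = K%:R * mu - 1.

Variable h : nat -> bool.
Hypothesis indic_drift : forall n s,
  period_avg h k (drift (indic R n s)) @[k --> \oo] --> (0 : R).
Hypothesis lin_drift : period_avg h k (drift (lin_pot p r)) @[k --> \oo] --> (0 : R).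

(** Along an ultrafilter all frequencies converge at once, and vanishing indicator drifts make the
    limit a multiple of [pi]. Mass might still escape to infinity; [idle] serves to exclude this. *)
Lemma frequency_cvg n s : period_avg h k (indic R n s) @[k --> \oo] --> pi n s.
Proof.
apply: cvg_ultra => U UU oU.
have PU : ProperFilter U by exact: ultra_proper.
have A01 m t k : 0 <= period_avg h k (indic R m t) <= 1.
  apply/andP; split.
    by rewrite /period_avg mulr_ge0// ?invr_ge0// sumr_ge0.
  rewrite -[leRHS](period_avg1 h k); apply: period_avg_le => m' t'.
  by rewrite /indic lern1 leq_b1.
pose q m t := lim (period_avg h k (indic R m t) @[k --> U]).
have qc m t : period_avg h k (indic R m t) @[k --> U] --> q m t.
  exact: ultra_bounded_cvg.
have q0 m t : 0 <= q m t.
  by apply: (cvgr_to_ge (qc m t)); apply: nearW => k; case/andP: (A01 m t k).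
have fin J M : (forall m t, (M <= m)%N -> J m t = 0) ->
    period_avg h k J @[k --> U] --> \sum_(m < M) \sum_(t : bool) q m t * J m t.
  by move=> JM; exact: (functional_cvg_finite (@period_avg_lin h) qc JM).
have q1 N : mass q N <= 1.
  have := @fin (fun m _ => (m < N)%N%:R) N; rewrite (_ : \sum_(m < N) _ = mass q N); last first.
    by apply: eq_bigr => m _; apply: eq_bigr => t _; rewrite ltn_ord mulr1.
  move=> c; apply: (cvgr_to_le (c _)); first by move=> m t; rewrite ltnNge => ->.
  apply: nearW => k; rewrite -[leRHS](period_avg1 h k); apply: period_avg_le => m t.
  by rewrite lern1 leq_b1.
have toU (u : nat -> R) l : u k @[k --> \oo] --> l -> u k @[k --> U] --> l.
  by move=> ul A /ul; exact: oU.
have qI : invariant p r K q.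
  move=> n' s' N nN; rewrite kern_widen//.
  have c1 : period_avg h k (fun m t => kern m t n' s') @[k --> U] -->
      \sum_(m < n' + K) \sum_(t : bool) q m t * kern m t n' s'.
    by apply: fin => m t; exact: kern0.
  have c2 : period_avg h k (fun m t => kern m t n' s') @[k --> U] --> q n' s'.
    have -> : (fun k => period_avg h k (fun m t => kern m t n' s')) =
        fun k => period_avg h k (drift (indic R n' s')) + period_avg h k (indic R n' s').
      apply/funext => k; rewrite -[X in X + _]mul1r -period_avg_lin; congr (period_avg h k _).
      by apply/funext => m; apply/funext => t; rewrite /drift arr_op_indic /indic; ring.
    by rewrite -[q n' s']add0r; apply: cvgD; [exact: toU|exact: qc].
  exact: (cvg_unique (@Rhausdorff R) c1 c2).
have qE n' s' : q n' s' = q 0%N Good / pi 0%N Good * pi n' s'.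
  exact: (invariant_unique hp hr hK).
set c := _ / _ in qE.
have D0 : 0 < K%:R * mu - 1 by apply: stable_drift.
(* [idle] sees finitely many levels, so its average tends to [c] times its [pi]-mean. By the
   vanishing drift of [lin_pot] it also tends to that mean itself, which is positive. *)
have c1 : c = 1.
  have e1 : period_avg h k idle @[k --> U] --> c * (K%:R * mu - 1).
    have := fin idle K idle0; rewrite (_ : \sum_(m < K) _ = c * (K%:R * mu - 1))//.
    rewrite -pi_idle mulr_sumr; apply: eq_bigr => m _.
    by rewrite mulr_sumr; apply: eq_bigr => t _; rewrite qE mulrA.
  have e2 : period_avg h k idle @[k --> U] --> K%:R * mu - 1.
    have -> : (fun k => period_avg h k idle) =
        fun k => period_avg h k (drift (lin_pot p r)) + (K%:R * mu - 1).
      apply/funext => k.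
      transitivity ((K%:R * mu - 1) * period_avg h k (fun _ _ => 1) +
          period_avg h k (drift (lin_pot p r))); last by rewrite period_avg1 mulr1 addrC.
      rewrite -period_avg_lin.
      congr (period_avg h k _).
      by apply/funext => m; apply/funext => t; rewrite /idle; ring.
    rewrite -[X in _ --> X]add0r; apply: cvgD; [exact: toU|exact: cvg_cst].
  have e : c * (K%:R * mu - 1) = K%:R * mu - 1 := cvg_unique (@Rhausdorff R) e1 e2.
  by apply: (mulIf (lt0r_neq0 D0)); rewrite e mul1r.
by have := qc n s; rewrite qE c1 mul1r.
Qed.

End Frequencies.

Lemma sum_periods (V : nmodType) (K : nat) (F : nat -> V) m : (0 < K)%N ->
  (forall t, ~~ (K %| t)%N -> F t = 0) ->
  \sum_(t < m * K) F t = \sum_(i < m) F (i * K)%N.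
Proof.
move=> K0 F0; elim: m => [|m IH]; first by rewrite mul0n !big_ord0.
rewrite mulSnr big_split_ord /= IH big_ord_recr /=; congr (_ + _).
rewrite (bigD1 (Ordinal K0))//= addn0 big1 ?addr0// => i i0.
apply: F0; rewrite dvdn_addr ?dvdn_mull// gtnNdvd// lt0n.
by apply: contra i0 => /eqP e; apply/eqP/val_inj.
Qed.

(** * From slot drifts to period drifts *)

Section PeriodDrift.
Variables (R : realType) (p r : R) (K : nat).
Hypotheses (hp : 0 < p < 1) (hr : 0 < r < 1) (hK : (2 <= K)%N).
Local Notation serve_op := (serve_op p r).

(* Interpolates f between two arrivals so that its drift is concentrated on the
   arrival slots. *)
Definition interpolate (f : nat -> bool -> R) t :=
  if (K %| t)%N then f else iter (K - t %% K) serve_op f.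

Lemma interpolate_le f C : (forall n s, `|f n s| <= C * n.+1%:R ^+ 2) ->
  forall t n s, `|interpolate f t n s| <= C * n.+1%:R ^+ 2.
Proof.
move=> fC t; rewrite /interpolate; case: ifP => // _.
by elim: (K - _)%N => [|k IH] //=; apply: serve_op_le.
Qed.

(** Between arrivals, serving the next interpolant once yields the present one; at an arrival the
    slot and the K - 1 services in the interpolant make up [arr_op]. *)
Lemma interpolate_drift f t n s :
  slot_drift p r K (interpolate f) t n s =
  if (K %| t)%N then drift p r K f n s else 0.
Proof.
rewrite /slot_drift /slot_op /interpolate.
case: (boolP (K %| t)%N) => [Kt|/negbTE Kt].
  have -> : (K %| t.+1)%N = false.
    by apply/negP => Kt1; have := dvdn_sub Kt1 Kt; rewrite subSnn dvdn1; lia.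
  have -> : (t.+1 %% K)%N = 1%N.
    by rewrite -addn1 -modnDml (eqP Kt) add0n modn_small.
  rewrite /drift arr_op_serve addn1; case: K hK => // K' _.
  by rewrite subn1.
rewrite addn0; have t0 : (0 < t %% K)%N by rewrite lt0n -/(dvdn K t) Kt.
have tK : (t %% K < K)%N by rewrite ltn_mod; lia.
have t1 : ((t %% K).+1 %% K)%N = (t.+1 %% K)%N by rewrite -addn1 modnDml addn1.
case: ifP => Kt1.
  have -> : (K - t %% K)%N = 1%N; last by rewrite subrr.
  move: Kt1; rewrite /dvdn -t1; case: (ltnP (t %% K).+1 K) => [lt|]; last by lia.
  by rewrite modn_small.
have lt : ((t %% K).+1 < K)%N.
  rewrite ltn_neqAle tK andbT; apply/eqP => e.
  by move: Kt1; rewrite /dvdn -t1 e modnn eqxx.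
rewrite -t1 modn_small//.
have -> : (K - t %% K)%N = (K - (t %% K).+1).+1 by lia.
by rewrite subrr.
Qed.

Lemma period_drift_sum f h m :
  \sum_(t < m * K) at_slot K (slot_drift p r K (interpolate f) t) t h =
  \sum_(i < m) at_slot K (drift p r K f) (i * K) h.
Proof.
rewrite (@sum_periods _ _ (fun t =>
  at_slot K (slot_drift p r K (interpolate f) t) t h)) ?(ltnW hK)//; last first.
  by move=> t /negPf Kt; rewrite /at_slot interpolate_drift Kt.
by apply: eq_bigr => i _; rewrite /at_slot interpolate_drift dvdn_mull.
Qed.

End PeriodDrift.

(** * Age of information under FCFS *)

Section AgeOfInformation.
Variable (K : nat).
Hypothesis hK : (2 <= K)%N.

Let K0 : (0 < K)%N. Proof. exact: ltnW. Qed.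

(* Number of arrivals in the slots 1, ..., t. *)
Definition narr t : nat := (t %/ K + ~~ (K %| t))%N.

Lemma narrS t : narr t.+1 = (narr t + (K %| t))%N.
Proof. by rewrite /narr divnS//; case: (K %| t)%N (K %| t.+1)%N => -[] /=; lia. Qed.

Lemma narr_mul m : narr (m * K) = m.
Proof. by rewrite /narr mulnK// dvdn_mull// addn0. Qed.

Lemma narr_add m k : (0 < k < K)%N -> narr (m * K + k) = m.+1.
Proof.
move=> /andP[k0 kK]; rewrite /narr divnMDl// divn_small// addn0.
by rewrite dvdn_addr ?dvdn_mull// gtnNdvd//= addn1.
Qed.

(** FCFS delivers in order of generation, so the number [d] of deliveries determines the state.
    Packet number [i], counted from 0, is generated in slot [i * K + 1]. *)
Lemma fcfsE s t : exists2 d, (d <= narr t)%N & fcfs K s t =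
  ([seq (i * K).+1 | i <- iota d (narr t - d)], rev [seq (i * K).+1 | i <- iota 0 d]) /\
  qlen K s t = (narr t - d)%N.
Proof.
elim: t => [|t [d dn [IH IHq]]].
  by exists 0%N; rewrite // /narr div0n dvdn0.
have e : (if arrival K t.+1 then rcons [seq (i * K).+1 | i <- iota d (narr t - d)] t.+1
      else [seq (i * K).+1 | i <- iota d (narr t - d)]) =
    [seq (i * K).+1 | i <- iota d (narr t.+1 - d)].
  rewrite /arrival /= narrS; case: (boolP (K %| t)%N) => Kt; last by rewrite addn0.
  rewrite addn1 subSn// -[(narr t - d).+1]addn1 iotaD map_cat /= cats1 subnKC//.
  by rewrite /narr Kt addn0 divnK.
have dS : (d <= narr t.+1)%N by rewrite narrS; lia.
have step : fcfs K s t.+1 = fcfs_step K t.+1 (s t.+1) (fcfs K s t) by [].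
rewrite step IH /fcfs_step e /= IHq.
case: (s t.+1); last first.
  exists d => //; split; last by rewrite narrS; lia.
  by case: [seq _ | _ <- _].
case nd : (narr t.+1 - d)%N => [|k] /=.
  exists d => //; split; first by rewrite nd.
  by move: nd; rewrite narrS; case: (K %| t)%N => /=; lia.
exists d.+1; first by lia.
split; last by move: nd; rewrite narrS; case: (K %| t)%N => /=; lia.
have -> : (narr t.+1 - d.+1)%N = k by lia.
congr (_, _).
have -> : iota 0 d.+1 = rcons (iota 0 d) d by rewrite -cats1 -addn1 iotaD.
by rewrite map_rcons rev_rcons.
Qed.

Lemma max_gens d :
  \max_(u <- rev [seq (i * K).+1 | i <- iota 0 d]) u = (if d is d'.+1 then (d' * K).+1 else 0)%N.
Proof.
elim: d => [|d IH]; first by rewrite big_nil.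
have -> : iota 0 d.+1 = rcons (iota 0 d) d by rewrite -cats1 -addn1 iotaD.
rewrite map_rcons rev_rcons big_cons IH; case: d {IH} => [|d]; first by rewrite maxn0.
by apply/maxn_idPl; rewrite ltnS leq_mul2r leqnSn orbT.
Qed.

Variable R : realType.
Implicit Type s : nat -> bool.

(* The age at the beginning of slot t + 1 once a packet has been delivered;
   before, the age is smaller by K - 1. *)
Definition steady_age s t : R := t%:R - (narr t)%:R * K%:R + K%:R + K%:R * (qlen K s t)%:R.

Lemma aoiE s t : aoi R K s t.+1 =
  steady_age s t - (K%:R - 1) * (qlen K s t == narr t)%:R.
Proof.
rewrite /aoi /latest_received /steady_age /=; have [d dn [-> ->]] := fcfsE s t.
rewrite /= max_gens.
case: d dn => [|d] dn.
  (* Before any delivery [latest_received] is 0 and the age is [t + 1], whereas [steady_age] is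
     [t + K]. *)
  rewrite subn0 eqxx -[t.+1%:R]natr1  /=; ring.
have -> : (narr t - d.+1 == narr t)%N = false by apply/eqP; lia.
rewrite natrB// -[t.+1%:R]natr1 -[d.+1%:R]natr1 -[(d * K).+1%:R]natr1 natrM.
by rewrite mulr0n; ring.
Qed.

Lemma aoi_ge0 s t : 0 <= aoi R K s t.+1.
Proof.
rewrite /aoi subr_ge0 ler_nat /latest_received /=; have [d dn [-> _]] := fcfsE s t.
rewrite /= max_gens; case: d dn => // d dn.
have dd : (d * K <= (narr t).-1 * K)%N by rewrite leq_mul2r; lia.
have : ((narr t).-1 * K <= t)%N.
  have := divn_eq t K; rewrite /narr; case: (boolP (K %| t)%N) => Kt /= e.
    by rewrite addn0 {2}e; apply: leq_trans (leq_addr _ _); rewrite leq_mul2r; lia.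
  by rewrite addn1 /= {2}e leq_addr.
lia.
Qed.

(** A delivery is never undone, so every index that counts lies below [t0]. *)
Lemma undelivered_sum s t0 M : (qlen K s t0 < narr t0)%N ->
  \sum_(t < M) (qlen K s t == narr t)%:R <= t0%:R :> R.
Proof.
move=> q0.
have later t : (t0 <= t)%N -> (qlen K s t < narr t)%N.
  move=> /subnKC <-; elim: (t - t0)%N => [|k IH]; first by rewrite addn0.
  by rewrite addnS narrS /=; case: (s _) => /=; lia.
rewrite -natr_sum ler_nat; elim: M => [|M IH]; first by rewrite big_ord0.
case: (leqP t0 M) => tM; rewrite big_ord_recr /=.
  by rewrite (ltn_eqF (later _ tM)) addn0.
apply: (@leq_trans M.+1) => //; rewrite -addn1 leq_add ?leq_b1//.
apply: (@leq_trans (\sum_(i < M) 1)); last by rewrite sum1_card card_ord.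
by apply: leq_sum => i _; exact: leq_b1.
Qed.

Lemma steady_age_sum s m : \sum_(t < m * K) steady_age s t =
  m%:R * (K%:R * (K%:R + 1) / 2) + K%:R * \sum_(t < m * K) (qlen K s t)%:R.
Proof.
rewrite /steady_age big_split /= -mulr_sumr; congr (_ + _).
elim: m => [|m IH]; first by rewrite mul0n big_ord0 mul0r.
rewrite mulSnr big_split_ord /= IH -[m.+1%:R]natr1 mulrDl mul1r; congr (_ + _).
(* At [i = 0] the arrival of the coming slot is not yet in [narr], so the elapsed time is K; the
   summands are K, 1, ..., K - 1. *)
have -> : \sum_(i < K) ((m * K + i)%:R - (narr (m * K + i))%:R * K%:R + K%:R) =
    \sum_(i < K) (i%:R + (i == 0%N :> nat)%:R * K%:R) :> R.
  apply: eq_bigr => i _; case: (posnP i) => [->|i0].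
    by rewrite addn0 narr_mul natrM /=; ring.
  by rewrite narr_add ?i0//= natrD natrM -[m.+1%:R]natr1 /=; ring.
rewrite big_split /= -mulr_suml.
have -> : \sum_(i < K) (i == 0%N :> nat)%:R = 1 :> R.
  rewrite (bigD1 (Ordinal K0))//= big1 ?addr0// => i i0.
  rewrite (_ : (i == 0%N :> nat) = false)//; apply/negbTE.
  by apply: contra i0 => /eqP e; apply/eqP/val_inj.
have -> n : \sum_(i < n) i%:R = n%:R * (n%:R - 1) / 2 :> R.
  elim: n => [|n IHn]; first by rewrite big_ord0 !mul0r.
  by rewrite big_ord_recr /= IHn -[n.+1%:R]natr1; field.
by field.
Qed.

End AgeOfInformation.

(** * From averages along squares to all averages *)

Section Interpolation.
Variables (R : realType) (K : nat).
Hypothesis K0 : (0 < K)%N.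

Lemma square_block N t : (N.+1 ^ 2 * K <= t)%N ->
  exists2 k, (N <= k)%N & (k.+1 ^ 2 * K <= t < k.+2 ^ 2 * K)%N.
Proof.
move=> Nt.
have bnd k : (k.+1 ^ 2 * K <= t)%N -> (k <= t)%N.
  by move=> kt; nia.
have ex : exists k, (k.+1 ^ 2 * K <= t)%N by exists N.
case: (ex_maxnP ex bnd) => k kt kmax; exists k; first exact: kmax.
by rewrite kt /= ltnNge; apply/negP => /kmax; rewrite ltnn.
Qed.

(** Consecutive squares have ratio tending to 1, so monotonicity squeezes every average between
    those at neighbouring squares. *)
Lemma cvg_average_of_squares (F : nat -> R) (l : R) :
  {homo F : m n / (m <= n)%N >-> m <= n} -> 0 <= F 0%N ->
  (k.+1 ^ 2)%:R^-1 * F (k.+1 ^ 2 * K)%N @[k --> \oo] --> K%:R * l ->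
  n%:R^-1 * F n @[n --> \oo] --> l.
Proof.
move=> mono F0 cF.
have Fge0 n : 0 <= F n by apply: le_trans F0 (mono _ _ _).
have Kn : K%:R != 0 :> R by rewrite pnatr_eq0 -lt0n.
pose u k := (k.+1 ^ 2)%:R^-1 * F (k.+1 ^ 2 * K)%N / K%:R.
have cu : u k @[k --> \oo] --> l.
  have -> : nbhs l = nbhs (K%:R * l / K%:R) by rewrite mulrAC divff// mul1r.
  exact: cvgMl.
have h0 := @cvg_harmonic R.
have h1 : (@harmonic R) k.+1 @[k --> \oo] --> (0 : R) by rewrite cvg_shiftS.
(* The squared factors are ratios of consecutive squares: they replace the normalisation at one
   square by that at its neighbour. *)
pose lo k := u k * (1 - harmonic k.+1) ^+ 2.
pose hi k := u k.+1 * (1 + harmonic k) ^+ 2.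
have clo : lo k @[k --> \oo] --> l.
  have -> : nbhs l = nbhs (l * ((1 - 0) * (1 - 0))) by rewrite subr0 !mulr1.
  by apply: cvgM => //; apply: cvgM; (apply: cvgB; [exact: cvg_cst|exact: h1]).
have chi : hi k @[k --> \oo] --> l.
  have -> : nbhs l = nbhs (l * ((1 + 0) * (1 + 0))) by rewrite addr0 !mulr1.
  apply: cvgM; first by rewrite cvg_shiftS.
  by apply: cvgM; (apply: cvgD; [exact: cvg_cst|exact: h0]).
apply/cvgrPdist_le => e e0.
move/cvgrPdist_le : clo => /(_ _ e0) [N1 _ lo1].
move/cvgrPdist_le : chi => /(_ _ e0) [N2 _ hi2].
exists ((maxn N1 N2).+1 ^ 2 * K)%N => // t /= Nt.
have [k Nk /andP[kt tk]] := square_block Nt.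
have := lo1 k (leq_trans (leq_maxl _ _) Nk); have := hi2 k (leq_trans (leq_maxr _ _) Nk).
have K1 : 0 < K%:R :> R by rewrite ltr0n.
have t0 : 0 < t%:R :> R by rewrite ltr0n (leq_trans _ kt)// muln_gt0 K0 expn_gt0.
have k1 : k.+1%:R != 0 :> R by [].
have k2 : k.+2%:R != 0 :> R by [].
have k12 : k.+2%:R = k.+1%:R + 1 :> R by rewrite natr1.
have lot : lo k <= t%:R^-1 * F t.
  have -> : lo k = (k.+2 ^ 2 * K)%:R^-1 * F (k.+1 ^ 2 * K)%N.
    rewrite /lo /u /harmonic natrM !natrX.
    have -> : 1 - k.+2%:R^-1 = k.+1%:R / k.+2%:R :> R.
      by apply: (mulIf k2); rewrite mulrBl mulVf// divfK// mul1r k12 addrK.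
    move: k1 k2 Kn; move: (k.+1%:R : R) (k.+2%:R : R) (K%:R : R) => x y z x0 y0 z0.
    by field; rewrite ?x0 ?y0 ?z0.
  apply: ler_pM; [by rewrite invr_ge0|by []| |exact: mono].
  by rewrite lef_pV2 ?posrE// ?ltr0n ?muln_gt0 ?K0 ?expn_gt0// ler_nat ltnW.
have hit : t%:R^-1 * F t <= hi k.
  have -> : hi k = (k.+1 ^ 2 * K)%:R^-1 * F (k.+2 ^ 2 * K)%N.
    rewrite /hi /u /harmonic natrM !natrX.
    have -> : 1 + k.+1%:R^-1 = k.+2%:R / k.+1%:R :> R.
      by apply: (mulIf k1); rewrite mulrDl mulVf// divfK// mul1r k12.
    move: k1 k2 Kn; move: (k.+1%:R : R) (k.+2%:R : R) (K%:R : R) => x y z x0 y0 z0.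
    by field; rewrite ?x0 ?y0 ?z0.
  apply: ler_pM; [by rewrite invr_ge0|by []| |by apply: mono; exact: ltnW].
  by rewrite lef_pV2 ?posrE// ?ltr0n ?muln_gt0 ?K0 ?expn_gt0// ler_nat.
by rewrite !ler_norml; lra.
Qed.

End Interpolation.

(** * Almost sure limits *)

Section AlmostSureLimits.
Context (d : measure_display) (T : measurableType d) (R : realType)
  (P : probability T R) (p r : R) (S : nat -> {RV P >-> bool}).
Hypothesis GE : is_GE_channel p r S.
Variable K : nat.
Hypotheses (hp : 0 < p < 1) (hr : 0 < r < 1) (hK : (2 <= K)%N).
Variables (pi : nat -> bool -> R) (beta E : R).
Hypotheses (pi0 : forall n s, 0 < pi n s) (piI : invariant p r K pi).
Hypotheses (hbeta : 0 < beta < 1) (pi_le : forall n s, pi n s <= E * beta ^+ n).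

Lemma ae_period_drift f C : (forall n s, `|f n s| <= C * n.+1%:R ^+ 2) ->
  {ae P, forall w,
    period_avg K (S^~ w) k (drift p r K f) @[k --> \oo] --> (0 : R)}.
Proof.
move=> fC.
have := ae_slot_drift GE hp hr hK pi0 piI hbeta pi_le (interpolate_le K hp hr fC).
apply: filterS => w; under eq_fun do rewrite period_drift_sum//.
by [].
Qed.

(** Moments are bounded in time, so division by squares leaves summable second moments. This
    guarantees a first delivery. *)
Lemma ae_qlen_negligible : {ae P, forall w,
  (k.+1 ^ 2)%:R^-1 * (qlen K (S^~ w) (k.+1 ^ 2 * K))%:R @[k --> \oo] --> (0 : R)}.
Proof.
have [B B0 m4] := moment4 GE hp hr hK pi0 piI hbeta pi_le.
apply: (@ae_cvg0_of_second_moment _ _ _ _ S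
  (fun k h => (k.+1 ^ 2)%:R^-1 * (qlen K h (k.+1 ^ 2 * K))%:R)
  (fun k => (k.+1 ^ 2 * K).+1) B) => k.
  move=> h h' e; rewrite (@qlen_local K _ h h')// => i /andP[i1 it].
  by rewrite e// i1 leqW.
set t := (k.+1 ^ 2 * K)%N; set x : R := (k.+1 ^ 2)%:R^-1.
have x1 : x ^+ 2 <= k.+1%:R ^- 2.
  rewrite -natrX -/x expr2 ler_piMl ?invr_ge0//.
  by rewrite /x invf_le1 ?ltr0n ?ler1n ?expn_gt0.
apply: (@le_trans _ _ (Ex S t.+1 (fun h => x ^+ 2 * at_slot K (fun n _ => n.+1%:R ^+ 4) t h))).
  apply: le_Ex => h; rewrite exprMn ler_wpM2l ?sqr_ge0//.
  rewrite (@le_trans _ _ ((qlen K h t).+1%:R ^+ 2))//.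
    by rewrite lerXn2r ?nnegrE// ler_nat.
  by rewrite ler_weXn2l// ler1n.
rewrite ExZ mulrC ler_pM// ?sqr_ge0//.
by apply: Ex_ge0 => h; rewrite /at_slot exprn_ge0.
Qed.

End AlmostSureLimits.

(** * Limits along a typical channel path *)

Section TypicalPath.
Variables (R : realType) (p r : R) (K : nat) (beta a b g : R).
Hypotheses (hp : 0 < p < 1) (hr : 0 < r < 1) (hK : (2 <= K)%N).
Hypothesis hstab : K%:R^-1 < r / (p + r).
Hypothesis hbeta : 0 < beta < 1.
Hypothesis hbeta_eq :
  (beta - \sum_(0 <= i < K.+1) beta ^+ i * PK p r K i Bad Bad)
    / (\sum_(0 <= i < K.+1) beta ^+ i * PK p r K i Good Bad)
  = (\sum_(0 <= i < K.+1) beta ^+ i * PK p r K i Bad Good)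
    / (beta - \sum_(0 <= i < K.+1) beta ^+ i * PK p r K i Good Good).
Hypothesis hA : matA p r K beta *m col3 a b g = col3 0 0 1.
Local Notation stat := (stat beta a b g).
Local Notation mu := (service_rate p r).
Local Notation drift := (drift p r K).

(** The drift of [lin_pot] has mean zero under the invariant law, which leaves only the capacity
    surplus; this supplies [pi_idle] to [frequency_cvg]. *)
Lemma stat_idle : \sum_(n < K) \sum_(s : bool) stat n s * idle p r K n s = K%:R * mu - 1.
Proof.
have cf : stat_mean beta a b g N (idle p r K) @[N --> \oo] -->
    \sum_(n < K) \sum_(s : bool) stat n s * idle p r K n s.
  apply: (functional_cvg_finite (@stat_mean_lin _ beta a b g) (@stat_mean_indic _ beta a b g)).
  exact: idle0.
have cd := @stat_mean_drift _ _ _ _ _ _ _ _ hp hr hK hbeta hbeta_eq hA _ _ (lin_pot_le hp hr).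
have c1 := stat_mass_cvg hbeta hA.
have c2 : stat_mean beta a b g N (idle p r K) @[N --> \oo] --> K%:R * mu - 1.
  have -> : stat_mean beta a b g ^~ (idle p r K) = fun N =>
      (K%:R * mu - 1) * stat_mean beta a b g N (fun _ _ => 1) +
      stat_mean beta a b g N (drift (lin_pot p r)).
    apply/funext => N; rewrite -stat_mean_lin; congr (stat_mean _ _ _ _ _ _).
    by apply/funext => n; apply/funext => s; rewrite /idle; ring.
  have -> : nbhs (K%:R * mu - 1 : R) = nbhs ((K%:R * mu - 1) * 1 + 0 : R).
    by rewrite mulr1 addr0.
  by apply: cvgD => //; apply: cvgMr.
exact: (cvg_unique (@Rhausdorff R) cf c2).
Qed.

Definition mean_sojourn : R :=
  a + (r * (1 - beta))^-1 * (1 + (r + beta * p) / (1 - beta)) * b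
  + (1 - beta)^-1 * (1 + (p + r) / (r * (1 - beta))) * g.

Lemma stat_mean_sojourn : stat_mean beta a b g N (sojourn p r) @[N --> \oo] --> mean_sojourn.
Proof.
have rn : r != 0 by case/andP: hr => r0 _; rewrite gt_eqF.
have prn : p + r != 0 by case/andP: hp => ? _; case/andP: hr => ? _; rewrite gt_eqF// addr_gt0.
have bn : 1 - beta != 0 by case/andP: hbeta => _ ?; rewrite gt_eqF// subr_gt0.
have := @stat_mean_affine _ beta a b g hbeta (fun s => 1 + (~~ s)%:R * r^-1) mu^-1.
rewrite (_ : _ + _ * g = mean_sojourn); last first.
  by rewrite /mean_sojourn /service_rate /=; field; rewrite rn prn bn.
rewrite (_ : (fun N => _) = stat_mean beta a b g ^~ (sojourn p r))//.
apply/funext => N; congr (stat_mean _ _ _ _ _ _).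
by apply/funext => n; apply/funext => s; rewrite /sojourn; ring.
Qed.

Variable h : nat -> bool.
Hypothesis h_indic : forall n s,
  period_avg K h k (drift (indic R n s)) @[k --> \oo] --> (0 : R).
Hypothesis h_lin : period_avg K h k (drift (lin_pot p r)) @[k --> \oo] --> (0 : R).
Hypothesis h_quad : period_avg K h k (drift (quad_pot p r)) @[k --> \oo] --> (0 : R).
Hypothesis h_bad : period_avg K h k (drift (bad_ind R)) @[k --> \oo] --> (0 : R).
Hypothesis h_slot : (k.+1 ^ 2)%:R^-1 * (\sum_(t < k.+1 ^ 2 * K)
   at_slot K (slot_drift p r K (fun=> quad_pot p r) t) t h) @[k --> \oo] --> (0 : R).
Hypothesis h_qlen : (k.+1 ^ 2)%:R^-1 * (qlen K h (k.+1 ^ 2 * K))%:R @[k --> \oo] --> (0 : R).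

(** [sojourn_limit] gives one limit for the empirical averages and for the truncated stationary
    means; the latter is known in closed form. *)
Lemma path_mean_sojourn : period_avg K h k (sojourn p r) @[k --> \oo] --> mean_sojourn.
Proof.
have [V HV] := sojourn_limit hp hr hK hstab stat.
have c1 : period_avg K h k (sojourn p r) @[k --> \oo] --> V.
  apply: HV => //; first exact: period_avg_lin.
    move=> n s; apply: (frequency_cvg hp hr hK hstab) => //.
    - exact: (stat_gt0 hp hr hK hbeta hbeta_eq hA).
    - exact: stat_invariant.
    - exact: (stat_mass_le1 hp hr hK hbeta hbeta_eq hA).
    - exact: stat_idle.
  by under eq_fun do rewrite period_avg1; exact: cvg_cst.
have c2 : stat_mean beta a b g N (sojourn p r) @[N --> \oo] --> V.
  apply: HV.
  - exact: stat_mean_lin.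
  - exact: stat_mean_indic.
  - exact: stat_mass_cvg hbeta hA.
  - exact: (@stat_mean_drift _ _ _ _ _ _ _ _ hp hr hK hbeta hbeta_eq hA _ _ (quad_pot_le hp hr)).
  - exact: (@stat_mean_drift _ _ _ _ _ _ _ _ hp hr hK hbeta hbeta_eq hA _ _ (@bad_ind_le R)).
by rewrite -(cvg_unique (@Rhausdorff R) c2 stat_mean_sojourn).
Qed.

(* Little's law. *)
Lemma qlen_average : (k.+1 ^ 2)%:R^-1 * (\sum_(t < k.+1 ^ 2 * K) (qlen K h t)%:R)
  @[k --> \oo] --> mean_sojourn - 1.
Proof.
(* In a slot that starts with [n] queued packets the drift of [quad_pot] is [- n], plus
   [sojourn n s - 1] if a packet arrives; summation isolates the queue length. *)
have E k : (k.+1 ^ 2)%:R^-1 * (\sum_(t < k.+1 ^ 2 * K) (qlen K h t)%:R) =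
    period_avg K h k (sojourn p r) - 1 -
    (k.+1 ^ 2)%:R^-1 * (\sum_(t < k.+1 ^ 2 * K)
      at_slot K (slot_drift p r K (fun=> quad_pot p r) t) t h).
  have -> : \sum_(t < k.+1 ^ 2 * K) at_slot K (slot_drift p r K (fun=> quad_pot p r) t) t h =
      \sum_(t < k.+1 ^ 2 * K) (if (K %| t)%N then at_slot K (sojourn p r) t h - 1 else 0) -
      \sum_(t < k.+1 ^ 2 * K) (qlen K h t)%:R.
    rewrite -sumrB; apply: eq_bigr => t _; rewrite /at_slot /slot_drift /slot_op serve_quad//.
    case: (K %| t)%N; last by rewrite addn0; ring.
    by rewrite addn1 quad_potS -[(qlen K h t).+1%:R]natr1; ring.
  have -> : \sum_(t < k.+1 ^ 2 * K) (if (K %| t)%N then at_slot K (sojourn p r) t h - 1 else 0) =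
      \sum_(i < k.+1 ^ 2) at_slot K (sojourn p r) (i * K) h - (k.+1 ^ 2)%:R.
    rewrite (@sum_periods _ _ (fun t => if (K %| t)%N then at_slot K (sojourn p r) t h - 1 else 0)).
    - rewrite -[(k.+1 ^ 2)%:R]mulr1 mulr_natl -[X in _ - _ *+ X]card_ord -sumr_const -sumrB.
      by apply: eq_bigr => i _; rewrite dvdn_mull.
    - exact: ltnW.
    - by move=> t /negPf ->.
  have : (k.+1 ^ 2)%:R != 0 :> R by rewrite pnatr_eq0 expn_eq0.
  by rewrite /period_avg; move: ((k.+1 ^ 2)%:R : R) => m m0; field.
under eq_fun do rewrite E.
have -> : nbhs (mean_sojourn - 1) = nbhs (mean_sojourn - 1 - 0) by rewrite subr0.
apply: cvgB h_slot.
by apply: cvgB; [exact: path_mean_sojourn|exact: cvg_cst].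
Qed.

Lemma avg_aoi_cvg :
  avg_aoi R K h tau @[tau --> \oo] --> mean_sojourn + (K%:R - 1) / 2.
Proof.
have K0 : (0 < K)%N by exact: ltnW.
have Kn : K%:R != 0 :> R by rewrite pnatr_eq0 -lt0n.
pose F tau := \sum_(t < tau) aoi R K h t.+1.
have -> : avg_aoi R K h = fun tau => tau%:R^-1 * F tau.
  by apply/funext => tau; rewrite /avg_aoi /F big_add1 big_mkord.
(* A negligible queue is eventually shorter than the number of arrivals, so some packet has been
   delivered. *)
have [t0 q0] : exists t0, (qlen K h t0 < narr K t0)%N.
  move/cvgrPdist_lt : h_qlen => /(_ 1 ltr01) [N _ HN].
  exists (N.+1 ^ 2 * K)%N; rewrite narr_mul//.
  have := HN N (leqnn N); rewrite /= sub0r normrN ger0_norm ?mulr_ge0 ?invr_ge0//.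
  by rewrite ltr_pdivrMl ?ltr0n ?expn_gt0// mulr1 ltr_nat.
pose U M : R := \sum_(t < M) (qlen K h t == narr K t)%:R.
have U0 M : 0 <= U M by apply: sumr_ge0.
have Ut M : U M <= t0%:R by exact: undelivered_sum.
have cU : (k.+1 ^ 2)%:R^-1 * U (k.+1 ^ 2 * K)%N @[k --> \oo] --> (0 : R).
  have hb : (harmonic k : R) * t0%:R @[k --> \oo] --> (0 : R).
    by rewrite -[X in _ --> X](mul0r (t0%:R : R)); apply: cvgMl; exact: cvg_harmonic.
  apply: (squeeze_cvgr _ (cvg_cst 0) hb); apply: nearW => k.
  rewrite mulr_ge0 ?invr_ge0//=; apply: ler_pM; rewrite ?invr_ge0//.
  by rewrite /harmonic lef_pV2 ?posrE ?ltr0n ?expn_gt0// ler_nat expnS leq_pmulr.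
apply: (cvg_average_of_squares K0).
- by apply/nondecreasing_seqP => n; rewrite /F big_ord_recr /= lerDl aoi_ge0.
- by rewrite /F big_ord0.
have E k : (k.+1 ^ 2)%:R^-1 * F (k.+1 ^ 2 * K)%N = K%:R * (K%:R + 1) / 2 +
    K%:R * ((k.+1 ^ 2)%:R^-1 * (\sum_(t < k.+1 ^ 2 * K) (qlen K h t)%:R)) -
    (K%:R - 1) * ((k.+1 ^ 2)%:R^-1 * U (k.+1 ^ 2 * K)%N).
  have -> : F (k.+1 ^ 2 * K)%N = \sum_(t < k.+1 ^ 2 * K) steady_age K R h t -
      (K%:R - 1) * U (k.+1 ^ 2 * K)%N.
    by rewrite /F /U mulr_sumr -sumrB; apply: eq_bigr => t _; rewrite aoiE.
  rewrite steady_age_sum//.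
  have : (k.+1 ^ 2)%:R != 0 :> R by rewrite pnatr_eq0 expn_eq0.
  by move: ((k.+1 ^ 2)%:R : R) => m m0; field.
under eq_fun do rewrite E.
have -> : nbhs (K%:R * (mean_sojourn + (K%:R - 1) / 2)) =
    nbhs (K%:R * (K%:R + 1) / 2 + K%:R * (mean_sojourn - 1) - (K%:R - 1) * 0).
  by congr nbhs; field.
apply: cvgB; last exact: cvgMr.
by apply: cvgD; [exact: cvg_cst|apply: cvgMr; exact: qlen_average].
Qed.

End TypicalPath.

Theorem mainTheorem7 (R : realType) (p r : R) (K : nat)
    (hp : 0 < p < 1) (hr : 0 < r < 1) (hK : (2 <= K)%N)
    (hstab : K%:R^-1 < r / (p + r))
    (d : measure_display) (T : measurableType d) (P : probability T R)
    (S : nat -> {RV P >-> chstate}) (hS : is_GE_channel p r S)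
    (beta : R) (hbeta : 0 < beta < 1)
    (hbeta_eq :
      (beta - \sum_(0 <= i < K.+1) beta ^+ i * PK p r K i Bad Bad)
        / (\sum_(0 <= i < K.+1) beta ^+ i * PK p r K i Good Bad)
      = (\sum_(0 <= i < K.+1) beta ^+ i * PK p r K i Bad Good)
        / (beta - \sum_(0 <= i < K.+1) beta ^+ i * PK p r K i Good Good))
    (p0G p0B p1G : R)
    (hA : matA p r K beta *m col3 p0G p0B p1G = col3 0 0 1) :
  {ae P, forall w,
    avg_aoi R K (fun t => S t w) tau @[tau --> \oo] -->
      p0G + (r * (1 - beta))^-1 * (1 + (r + beta * p) / (1 - beta)) * p0B
      + (1 - beta)^-1 * (1 + (p + r) / (r * (1 - beta))) * p1G
      + (K%:R - 1) / 2}.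
Proof.
have pi0 := stat_gt0 hp hr hK hbeta hbeta_eq hA.
have piI := stat_invariant hp hr hK hbeta hbeta_eq hA.
have [E E0 pi_le] := stat_le_geom hp hr hK hbeta hbeta_eq hA.
have period_drift f C := @ae_period_drift _ _ _ _ _ _ _ hS _ hp hr hK _ _ _ pi0 piI hbeta pi_le f C.
have a_indic : {ae P, forall w, forall n s,
    period_avg K (S^~ w) k (drift p r K (indic R n s)) @[k --> \oo] --> (0 : R)}.
  apply: ae_foralln => n.
  have aT := period_drift _ _ (@indic_le R n true).
  have aF := period_drift _ _ (@indic_le R n false).
  by apply: filterS (filterI aT aF) => w [? ?] [].
have a_lin := period_drift _ _ (lin_pot_le hp hr).
have a_quad := period_drift _ _ (quad_pot_le hp hr).
have a_bad := period_drift _ _ (@bad_ind_le R).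
(* Little's law involves every slot, so here the potential is constant in time instead of
   interpolated. *)
have a_slot := ae_slot_drift hS hp hr hK pi0 piI hbeta pi_le (fun _ => quad_pot_le hp hr).
have a_qlen := ae_qlen_negligible hS hp hr hK pi0 piI hbeta pi_le.
apply: filter_app a_qlen; apply: filter_app a_slot; apply: filter_app a_bad.
apply: filter_app a_quad; apply: filter_app a_lin; apply: filterS a_indic => w hi hl hq hb hs hn.
exact: (avg_aoi_cvg hp hr hK hstab hbeta hbeta_eq hA hi hl hq hb hs hn).
Qed.
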